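(* Let $n\ge 1$, let $P\in\mathscr{P}_n$ with $P(z)\neq 0$ for $|z|<1$, and let $B\in\mathcal{B}_n$ with coefficients $\lambda_0,\lambda_1,\lambda_2$. Then for all $\alpha,\beta\in\mathbb{C}$ with $|\alpha|\le 1$, $|\beta|\le 1$, all real $R>r\ge 1$ and all $0\le p<\infty$, writing $\phi_n=\phi_n(R,r,\alpha,\beta)$, $\sigma(z)=Rz$ and $\rho(z)=rz$, $$\left\|B[P\circ\sigma](z)+\phi_n\,B[P\circ\rho](z)\right\|_p\le \frac{\left\|(R^n+\phi_n r^n)\Lambda_n z+(1+\phi_n)\lambda_0\right\|_p}{\|1+z\|_p}\,\|P(z)\|_p .$$ The result is best possible, and equality holds for $P(z)=az^n+b$ with $|a|=|b|\neq 0$.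
   Context: $\mathscr{P}_n$ denotes the class of complex polynomials $P(z)=\sum_{j=0}^n a_jz^j$ of degree $n$. For a polynomial $P$, $\|P(z)\|_0:=\exp\left\{\frac1{2\pi}\int_0^{2\pi}\log|P(e^{i\theta})|\,d\theta\right\}$ and $\|P(z)\|_p:=\left\{\frac1{2\pi}\int_0^{2\pi}|P(e^{i\theta})|^p\,d\theta\right\}^{1/p}$ for $0<p<\infty$. $(P\circ\psi)(z):=P(\psi(z))$. $\mathcal{B}_n$ is the class of operators $B$ of the form $$B[P](z):=\lambda_0P(z)+\lambda_1\left(\frac{nz}{2}\right)\frac{P'(z)}{1!}+\lambda_2\left(\frac{nz}{2}\right)^2\frac{P''(z)}{2!},$$ where $\lambda_0,\lambda_1,\lambda_2\in\mathbb{C}$ are such that all the zeros of $u(z):=\lambda_0+\binom n1\lambda_1z+\binom n2\lambda_2z^2$ lie in the half plane $|z|\le|z-n/2|$. $\Lambda_n:=\lambda_0+\lambda_1\frac{n^2}{2}+\lambda_2\frac{n^3(n-1)}{8}$. $\phi_n(R,r,\alpha,\beta):=\beta\left\{\left(\frac{R+1}{r+1}\right)^n-|\alpha|\right\}-\alpha$. *)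

(* Defs.v *)
From HB Require Import structures.
From mathcomp Require Import all_boot all_order all_algebra.
From mathcomp Require Import complex.
From mathcomp Require Import all_classical all_reals all_analysis.
Set Implicit Arguments.
Unset Strict Implicit.
Unset Printing Implicit Defensive.
Import Order.TTheory GRing.Theory Num.Theory.
Import numFieldNormedType.Exports.
Local Open Scope classical_set_scope.
Local Open Scope complex_scope.
Local Open Scope ring_scope.

Section Defs.
Context {K : realType}.
Local Notation C := K[i].

Definition unit_circle (t : K) : C := cos t +i* sin t.

(* The norm [`|z|] of [z : C] is an element of C, hence [Re]. *)
Definition cmod (z : C) : K := complex.Re `|z|.

(* The logarithm is extended, with [lne 0 = -oo], so that zeros on the circle
   are handled as usual and the zero polynomial has norm [expeR -oo = 0]. *)
Definition norm0 (P : {poly C}) : K :=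
  fine (expeR (((2 * pi)^-1)%:E *
    \int[lebesgue_measure]_(t in `[0%R, (2 * pi)%R])
      lne (cmod P.[unit_circle t])%:E)%E).

Definition normp (p : K) (P : {poly C}) : K :=
  if p == 0 then norm0 P
  else ((2 * pi)^-1 *
    \int[lebesgue_measure]_(t in `[0%R, (2 * pi)%R])
      (cmod P.[unit_circle t] `^ p)) `^ p^-1.

Definition Pn (n : nat) (P : {poly C}) : Prop := size P = n.+1.

Definition zero_free_disc (P : {poly C}) : Prop :=
  forall z : C, `|z| < 1 -> P.[z] != 0.

Definition Bop (n : nat) (l0 l1 l2 : C) (P : {poly C}) : {poly C} :=
  l0 *: P
  + l1 *: (((n%:R / 2) *: 'X) * ((1`!%:R)^-1 *: P^`()))
  + l2 *: (((n%:R / 2) *: 'X) ^+ 2 * ((2`!%:R)^-1 *: P^`(2))).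

Definition upoly (n : nat) (l0 l1 l2 : C) : {poly C} :=
  l0%:P + ('C(n, 1)%:R * l1) *: 'X + ('C(n, 2)%:R * l2) *: 'X^2.

Definition inB (n : nat) (l0 l1 l2 : C) : Prop :=
  forall z : C, root (upoly n l0 l1 l2) z -> `|z| <= `|z - n%:R / 2|.

Definition Lambda (n : nat) (l0 l1 l2 : C) : C :=
  l0 + l1 * (n%:R ^+ 2 / 2) + l2 * (n%:R ^+ 3 * (n%:R - 1) / 8).

Definition phi (n : nat) (R r : K) (alpha beta : C) : C :=
  beta * ((((R + 1) / (r + 1)) ^+ n)%:C - `|alpha|) - alpha.

Definition dilate (R : K) (P : {poly C}) : {poly C} := P \Po (R%:C *: 'X).

End Defs.

(* Main.v *)
Require Import Defs.
From HB Require Import structures.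
From mathcomp Require Import all_boot all_order all_algebra.
From mathcomp Require Import complex.
From mathcomp Require Import all_classical all_reals all_analysis.
From mathcomp Require Import measurable_realfun.
From mathcomp Require Import ring lra zify.
Set Implicit Arguments.
Unset Strict Implicit.
Unset Printing Implicit Defensive.
Import Order.TTheory GRing.Theory Num.Theory.
Import numFieldNormedType.Exports.
Local Open Scope classical_set_scope.
Local Open Scope complex_scope.
Local Open Scope ring_scope.

(** Write T for the operator P |-> B[P(Rz)] + phi B[P(rz)]. It multiplies z^k
    by a number t_k, where t_n = (R^n + phi r^n) Lambda_n and
    t_0 = (1 + phi) lambda_0. The inequality thus reads
    |T P|_p |1 + z|_p <= |t_n z + t_0|_p |P|_p for P zero-free in the open
    unit disc.

    T maps the polynomials of degree n with all zeros in the closed disc to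
    polynomials without zeros outside it. For the dilations this holds because
    |P(Rz)| > ((R+1)/(r+1))^n |P(rz)| >= |phi P(rz)| when |z| > 1
    ([dilation_ratio_lt], [cmod_phi_le]); for B it is Walsh's coincidence
    theorem applied to u, where only the degree two case is needed once
    Gauss-Lucas has reduced the n zeros of P to two points ([Bop_neq0]).
    Conjugating T by P |-> P* = z^n conj (P (1 / conj z)) gives an operator T'
    which preserves the polynomials without zeros in the open disc, and
    |T P| <= |T' P| on the circle for such P ([star_preserver], [le_star]).
    By the maximum principle T' + eta T has the same preservation property for
    |eta| < 1.

    A preserver S, with constant term S F (0) = s0 F(0), satisfies Arestov's
    inequality: the mean of |S F|^p on the circle is at most |s0|^p times that
    of |F|^p ([arestov]). For p = 0 ([preserver_norm0]), reflecting the zeros of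
    F which lie in the disc gives a zero-free G with |G| = |F| on the circle;
    S G dominates S F there, and Jensen's formula evaluates the geometric means
    of the zero-free S G and G at the origin. For p > 0, this is applied to
    F + c e^(i gamma); averaging over gamma replaces log |F| by
    log max(|F|, c), and x^p is an integral over c of log^+ (x / c).

    Arestov's inequality for T' + rho e^(i gamma) T is averaged over gamma. Its
    left side is bounded below using |T P| <= |T' P|, which produces the factor
    |1 + z|_p; its right side contains the mean of
    |conj t_n + rho e^(i gamma) t_0|^p; then rho tends to 1
    ([power_integral_star]). For p = 0 one has directly
    |T P|_0 <= |T' P|_0 = |t_n P(0)| = |t_n| |P|_0.

    Finally T (a z^n + b) = t_n a z^n + t_0 b, and the means of a z^n + b depend
    only on |a| and |b|; this gives the equality cases, hence sharpness. *)


(** * Integrals of periodic functions *)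

Section Periodic.
Context {K : realType}.
Local Notation mu := (@lebesgue_measure K).
Implicit Types (f : K -> \bar K) (a c : K).

Lemma measurable_affine c a :
  measurable_fun [set: measurableTypeR K]
    ((fun x => c * x + a) : measurableTypeR K -> measurableTypeR K).
Proof.
by apply: measurable_funD => //; apply: measurable_funM.
Qed.

Lemma lebesgue_measure_affine c a (A : set K) : 0 < c -> measurable A ->
  mu A = (c%:E * mu ((fun x => c * x + a)%R @^-1` A))%E.
Proof.
move=> c0 mA.
pose m := mscale (NngNum (ltW c0))
  (measure_function_pushforward__canonical__measure_function_Measure mu (measurable_affine c a)).
pose m' : {measure set (measurableTypeR K) -> \bar K} := m.
rewrite (_ : (_ * _)%E = m' A) //.
apply: lebesgue_measure_unique => // _ [[x y]] _ <-.
rewrite -[RHS]/(c%:E * mu ((fun t => c * t + a)%R @^-1` `]x, y]))%E.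
rewrite (_ : _ @^-1` _ = `](x - a) / c, (y - a) / c]%classic); last first.
  apply/seteqP; split => t /=; rewrite !in_itv /=;
  by rewrite ltr_pdivrMr // ler_pdivlMr // ltrBlDr lerBrDr mulrC.
rewrite !lebesgue_measure_itv /= !lte_fin.
rewrite ltr_pM2r ?invr_gt0 // ltrD2r.
case: ifP => _; last by rewrite mule0.
by rewrite -!EFinD -EFinM; congr (_%:E); field; rewrite gt_eqF.
Qed.

(** The push-forward of Lebesgue measure under x -> c x + a is its multiple by 1/c, and
    nonnegative integrals are transported along push-forwards. *)
Lemma ge0_integral_affine c a (D : set K) f : 0 < c -> measurable D ->
  measurable_fun setT f -> (forall x, 0 <= f x)%E ->
  (\int[mu]_(x in D) f x =
   c%:E * \int[mu]_(x in (fun x => c * x + a)%R @^-1` D) f (c * x + a)%R)%E.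
Proof.
move=> c0 mD mf f0.
have := @ge0_integral_pushforward _ _ _ _ K _ (measurable_affine c a) mu D f
  mD (measurable_funTS mf) (fun y _ => f0 y).
rewrite /comp => <-.
pose m : {measure set (measurableTypeR K) -> \bar K} :=
  measure_function_pushforward__canonical__measure_function_Measure mu (measurable_affine c a).
have := @ge0_integral_mscale _ _ _ m D mD (NngNum (ltW c0)) f
  (measurable_funTS mf) (fun y _ => f0 y).
rewrite /= => <-.
apply: eq_measure_integral => A mA _.
exact: lebesgue_measure_affine.
Qed.

Lemma ge0_integral_shift a (x y : K) f :
  measurable_fun setT f -> (forall t, 0 <= f t)%E ->
  (\int[mu]_(t in `[(x + a)%R, (y + a)%R[) f t = \int[mu]_(t in `[x, y[) f (t + a)%R)%E.
Proof.
move=> mf f0; rewrite (@ge0_integral_affine 1 a) // mul1e.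
under eq_integral do rewrite mul1r.
congr (integral _ _ _); apply/seteqP; split=> t /=;
by rewrite !in_itv /= mul1r lerD2r ltrD2r.
Qed.

Lemma ge0_integral_itvU (x y z : K) f : x <= y -> y <= z ->
  measurable_fun setT f -> (forall t, 0 <= f t)%E ->
  (\int[mu]_(t in `[x, z[) f t =
   \int[mu]_(t in `[x, y[) f t + \int[mu]_(t in `[y, z[) f t)%E.
Proof.
move=> xy yz mf f0.
rewrite (@itv_bndbnd_setU _ _ (BLeft x) (BLeft y) (BLeft z)) ?bnd_simp //.
rewrite ge0_integral_setU //; first exact: measurable_funTS.
apply/disj_setPS => t [] /=; rewrite !in_itv /= => /andP[_ ty] /andP[yt _].
by move: (lt_le_trans ty yt); rewrite ltxx.
Qed.

Definition circle_integral f : \bar K := (\int[mu]_(t in `[0%R, (2 * pi)%R]) f t)%E.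

Lemma circle_integralE f : measurable_fun setT f ->
  circle_integral f = (\int[mu]_(t in `[0%R, (2 * pi)%R[) f t)%E.
Proof.
by move=> mf; rewrite /circle_integral -integral_itv_bndo_bndc //; exact: measurable_funTS.
Qed.

Lemma pi2_ge0 : 0 <= 2 * pi :> K.
Proof. by rewrite mulr_ge0 // pi_ge0. Qed.

(** The interval [a, 2 pi + a[ consists of [a, 2 pi[ and of the translate of [0, a[
    by a period. *)
Lemma circle_integral_shift a f : 0 <= a <= 2 * pi ->
  measurable_fun setT f -> (forall t, 0 <= f t)%E ->
  (forall t, f (t + 2 * pi) = f t) ->
  circle_integral (fun t => f (t + a)) = circle_integral f.
Proof.
move=> /andP[a0 api] mf f0 fper.
have mfa : measurable_fun setT (fun t : K => f (t + a)).
  by apply: (measurableT_comp mf); exact: measurable_funD.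
rewrite !circle_integralE // -ge0_integral_shift // add0r.
have pia : 2 * pi <= 2 * pi + a by rewrite lerDl.
rewrite (@ge0_integral_itvU a (2 * pi)) //.
rewrite (@ge0_integral_itvU 0 a (2 * pi)) // addeC; congr (_ + _)%E.
rewrite -[X in `[X, _[]add0r [2 * pi + a]addrC ge0_integral_shift //.
by apply: eq_integral => t _.
Qed.

(** Scaling by n turns [0, 2 pi[ into n consecutive periods. *)
Lemma circle_integral_muln n f : (0 < n)%N ->
  measurable_fun setT f -> (forall t, 0 <= f t)%E ->
  (forall t, f (t + 2 * pi) = f t) ->
  circle_integral (fun t => f (n%:R * t)) = circle_integral f.
Proof.
move=> n0 mf f0 fper.
have mfa : measurable_fun setT (fun t : K => f (n%:R * t)).
  by apply: (measurableT_comp mf); exact: measurable_funM.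
have nR : 0 < n%:R :> K by rewrite ltr0n.
rewrite !circle_integralE //.
have perk k t : f (t + k%:R * (2 * pi)) = f t.
  elim: k t => [|k IH] t; first by rewrite mul0r addr0.
  by rewrite -natr1 mulrDl mul1r addrA fper IH.
have blocks : (\int[mu]_(t in `[0%R, (n%:R * (2 * pi))%R[) f t =
   n%:R%:E * \int[mu]_(t in `[0%R, (2 * pi)%R[) f t)%E.
  elim: (n) => [|k IH].
    by rewrite mul0r mul0e set_itvco0 integral_set0.
  have kk1 : k%:R * (2 * pi) <= k.+1%:R * (2 * pi) :> K.
    by rewrite ler_wpM2r ?pi2_ge0 // ler_nat.
  rewrite (@ge0_integral_itvU 0 (k%:R * (2 * pi))) ?mulr_ge0 ?pi_ge0 //.
  have k1E : k.+1%:R * (2 * pi) = 2 * pi + k%:R * (2 * pi) :> K.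
    by rewrite -(natr1 k); ring.
  rewrite IH k1E -[X in `[X, _[]add0r.
  rewrite ge0_integral_shift //.
  under [X in (_ + X)%E]eq_integral do rewrite perk.
  by rewrite -(natr1 k) EFinD ge0_muleDl ?mul1e // lee_fin.
have := @ge0_integral_affine n%:R 0 `[0, n%:R * (2 * pi)[ f nR
  (measurable_itv _) mf f0.
rewrite blocks.
have -> : (fun x : K => n%:R * x + 0) @^-1` `[0, n%:R * (2 * pi)[ =
    `[0, 2 * pi[%classic.
  apply/seteqP; split=> t /=; rewrite !in_itv /= addr0 pmulr_rge0 //;
  by rewrite ltr_pM2l.
under [in X in _ = X -> _]eq_integral do rewrite addr0.
move=> /(congr1 (fun x => (n%:R^-1)%:E * x)%E).
by rewrite !muleA -!EFinM mulVf ?gt_eqF // !mul1e.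
Qed.
End Periodic.

(** * Moduli and the unit circle *)

Section Modulus.
Context {K : realType}.
Local Notation C := K[i].
Implicit Types (z w : C) (t : K).

Lemma normr_cmod z : `|z| = (cmod z)%:C.
Proof. by rewrite /cmod normc_def. Qed.

Lemma cmod_sqrt z : cmod z = Num.sqrt (complex.Re z ^+ 2 + complex.Im z ^+ 2).
Proof. by rewrite /cmod normc_def. Qed.

Lemma cmod_ge0 z : 0 <= cmod z.
Proof. by rewrite cmod_sqrt sqrtr_ge0. Qed.
Hint Resolve cmod_ge0 : core.

Lemma sqr_cmod z : cmod z ^+ 2 = complex.Re z ^+ 2 + complex.Im z ^+ 2.
Proof. by rewrite cmod_sqrt sqr_sqrtr // addr_ge0 ?sqr_ge0. Qed.

Lemma cmodM z w : cmod (z * w) = cmod z * cmod w.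
Proof. by apply: complexI; rewrite rmorphM /= -!normr_cmod normrM. Qed.

Lemma cmodX z k : cmod (z ^+ k) = cmod z ^+ k.
Proof. by apply: complexI; rewrite rmorphXn /= -!normr_cmod normrX. Qed.

Lemma cmodV z : cmod z^-1 = (cmod z)^-1.
Proof. by apply: complexI; rewrite fmorphV /= -!normr_cmod normfV. Qed.

Lemma cmodN z : cmod (- z) = cmod z.
Proof. by rewrite /cmod normrN. Qed.

Lemma cmodB z w : cmod (z - w) = cmod (w - z).
Proof. by rewrite -cmodN opprB. Qed.

Lemma cmod0 : cmod (0 : C) = 0. Proof. by rewrite /cmod normr0. Qed.
Lemma cmod1 : cmod (1 : C) = 1. Proof. by rewrite /cmod normr1. Qed.

Lemma cmod_real t : cmod t%:C = `|t|.
Proof. by rewrite cmod_sqrt /= expr0n /= addr0 sqrtr_sqr. Qed.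

Lemma cmod_conj z : cmod z^*%C = cmod z.
Proof. by rewrite !cmod_sqrt; case: z => a b /=; rewrite sqrrN. Qed.

Lemma ler_cmodD z w : cmod (z + w) <= cmod z + cmod w.
Proof. by rewrite -lecR rmorphD /= -!normr_cmod ler_normD. Qed.

Lemma ler_cmodB z w : cmod z - cmod w <= cmod (z - w).
Proof. by rewrite lerBlDr; apply: le_trans (ler_cmodD _ _); rewrite subrK. Qed.

Lemma cmod_eq0 z : (cmod z == 0) = (z == 0).
Proof. by rewrite -(inj_eq (@complexI K)) -normr_cmod normr_eq0. Qed.

Lemma cmod_gt0 z : (0 < cmod z) = (z != 0).
Proof. by rewrite lt_def cmod_eq0 cmod_ge0 andbT. Qed.

Lemma normr_lt1 z : (`|z| < 1) = (cmod z < 1).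
Proof. by rewrite normr_cmod -ltcR. Qed.

Local Notation u := (@unit_circle K).

Lemma cmod_circle t : cmod (u t) = 1.
Proof. by rewrite cmod_sqrt /= cos2Dsin2 sqrtr1. Qed.

Lemma circleD s t : u (s + t) = u s * u t.
Proof. by rewrite /u cosD sinD; congr Complex; rewrite /=; ring. Qed.

Lemma circle_period t : u (t + 2 * pi) = u t.
Proof.
have -> : 2 * pi = pi *+ 2 :> K by rewrite mulr_natl.
by rewrite circleD /u cos2pi sin2pi; simpc.
Qed.

Lemma circle0 : u 0 = 1.
Proof. by rewrite /u cos0 sin0. Qed.

Lemma circleMn n t : u (n%:R * t) = u t ^+ n.
Proof.
elim: n => [|n IH]; first by rewrite mul0r circle0 expr0.
by rewrite -(natr1 n) mulrDl mul1r circleD IH exprSr.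
Qed.

Lemma circle_neq0 t : u t != 0.
Proof. by rewrite -cmod_gt0 cmod_circle. Qed.

Lemma circle_conj t : u t * (u t)^*%C = 1.
Proof. by rewrite -sqr_normc normr_cmod cmod_circle expr1n. Qed.

Lemma polar z : exists2 s, 0 <= s <= 2 * pi & z = (cmod z)%:C * u s.
Proof.
have [->|z0] := eqVneq z 0.
  by exists 0; rewrite ?cmod0 ?mul0r // lexx mulr_ge0 ?pi_ge0.
have m0 : cmod z != 0 by rewrite cmod_eq0.
set x := complex.Re z / cmod z; set y := complex.Im z / cmod z.
have xy : x ^+ 2 + y ^+ 2 = 1.
  by rewrite /x /y !expr_div_n -mulrDl -sqr_cmod divff // expf_neq0.
have x1 : -1 <= x <= 1.
  by rewrite -ler_norml -(@ler_pXn2r _ 2) ?nnegrE // real_normK ?num_real //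
    expr1n -xy lerDl sqr_ge0.
have [/andP[s0 sp] cs] := acos_def x1.
have zE s : cos s = x -> sin s = y -> z = (cmod z)%:C * u s.
  rewrite /u => -> ->; rewrite /x /y; move: m0; move: (cmod z) => m m0.
  case: z {z0 x y xy x1 s0 sp cs} => a b /=; simpc.
  by congr Complex; field.
(* acos fixes the cosine; the sign of the sine decides between s and 2 pi - s *)
have sn : sin (acos x) ^+ 2 = y ^+ 2.
  by move: (cos2Dsin2 (acos x)); rewrite cs -xy => /addrI.
move/eqP: sn; rewrite eqf_sqr => /orP[/eqP sn|/eqP sn].
  by exists (acos x); [rewrite s0 /= (le_trans sp) // ler_peMl ?pi_ge0 // ler1n|exact: zE].
exists (2 * pi - acos x).
  rewrite subr_ge0 lerBlDr lerDl s0 andbT (le_trans sp) // ler_peMl ?pi_ge0 //.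
  by rewrite ler1n.
have c2 : cos (2 * pi - acos x) = x /\ sin (2 * pi - acos x) = y.
  have -> : 2 * pi = pi *+ 2 :> K by rewrite mulr_natl.
  by rewrite cosB sinB cos2pi sin2pi cs sn; split; ring.
by apply: zE; case: c2.
Qed.

End Modulus.
#[global] Hint Extern 0 (is_true (0 <= cmod _)) => solve [exact: cmod_ge0] : core.

(** * Measurability of complex-valued functions *)

Section Measurability.
Context {K : realType}.
Local Notation C := K[i].

(** Measurability of a complex-valued function, by components: no sigma-algebra
    is attached to the field K[i]. *)
Definition cmeasurable d (T : measurableType d) (z : T -> C) :=
  measurable_fun setT (fun t => complex.Re (z t)) /\
  measurable_fun setT (fun t => complex.Im (z t)).

Section Closure.
Context d (T : measurableType d).
Implicit Types z w : T -> C.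

Lemma cmeasurable_cst (c : C) : cmeasurable (fun _ : T => c).
Proof. by split; exact: measurable_cst. Qed.

Lemma cmeasurableD z w : cmeasurable z -> cmeasurable w ->
  cmeasurable (fun t => z t + w t).
Proof.
move=> [zr zi] [wr wi]; split.
  rewrite (_ : (fun t => _) = (fun t => complex.Re (z t) + complex.Re (w t))).
    exact: measurable_funD.
  by apply/funext => t; case: (z t); case: (w t).
rewrite (_ : (fun t => _) = (fun t => complex.Im (z t) + complex.Im (w t))).
  exact: measurable_funD.
by apply/funext => t; case: (z t); case: (w t).
Qed.

Lemma cmeasurableM z w : cmeasurable z -> cmeasurable w ->
  cmeasurable (fun t => z t * w t).
Proof.
move=> [zr zi] [wr wi]; split.
  rewrite (_ : (fun t => _) = (fun t => complex.Re (z t) * complex.Re (w t)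
    - complex.Im (z t) * complex.Im (w t))).
    by apply: measurable_funB; exact: measurable_funM.
  by apply/funext => t; case: (z t); case: (w t).
rewrite (_ : (fun t => _) = (fun t => complex.Re (z t) * complex.Im (w t)
    + complex.Im (z t) * complex.Re (w t))).
  by apply: measurable_funD; exact: measurable_funM.
by apply/funext => t; case: (z t); case: (w t).
Qed.

Lemma cmeasurable_horner (P : {poly C}) z : cmeasurable z ->
  cmeasurable (fun t => P.[z t]).
Proof.
move=> mz; elim/poly_ind: P => [|P c IH].
  rewrite (_ : (fun t => _) = cst 0); first exact: cmeasurable_cst.
  by apply/funext => t; rewrite horner0.
rewrite (_ : (fun t => _) = (fun t => P.[z t] * z t + c)).
  by apply: cmeasurableD; [exact: cmeasurableM|exact: cmeasurable_cst].
by apply/funext => t; rewrite !hornerE.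
Qed.

Lemma measurable_cmod z : cmeasurable z -> measurable_fun setT (fun t => cmod (z t)).
Proof.
move=> [zr zi].
rewrite (_ : (fun t => _) = (fun t => (complex.Re (z t) ^+ 2
   + complex.Im (z t) ^+ 2) `^ 2^-1)).
  apply: (measurableT_comp (measurable_powR _)).
  by apply: measurable_funD; exact: measurable_funX.
by apply/funext => t; rewrite cmod_sqrt powR12_sqrt // addr_ge0 ?sqr_ge0.
Qed.

Lemma measurable_lne (f : T -> K) : measurable_fun setT f ->
  measurable_fun setT (fun t => lne (f t)%:E).
Proof.
move=> mf; rewrite /lne; apply: measurable_fun_ifT.
- by apply: measurable_fun_ler => //; exact: measurable_cst.
- exact: measurable_cst.
- by apply/measurable_EFinP; exact: (measurableT_comp (@measurable_ln K)).
Qed.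

End Closure.

Lemma cmeasurable_circle d (T : measurableType d) (f : T -> K) :
  measurable_fun setT f -> cmeasurable (fun t => unit_circle (f t)).
Proof.
move=> mf; split => /=.
  by apply: (measurableT_comp (f := cos)) mf; apply: continuous_measurable_fun => t; exact: continuous_cos.
by apply: (measurableT_comp (f := sin)) mf; apply: continuous_measurable_fun => t; exact: continuous_sin.
Qed.

Lemma bounded_horner (P : {poly C}) (r : K) :
  {M : K | 0 <= M & forall z, cmod z <= r -> cmod P.[z] <= M}.
Proof.
elim/poly_ind: P => [|P c [M M0 IH]].
  by exists 0 => // z _; rewrite horner0 cmod0.
have [r0|r0] := leP 0 r; last first.
  by exists 0 => // z zr; have := lt_le_trans (le_lt_trans zr r0) (cmod_ge0 z); rewrite ltxx.
exists (M * r + cmod c) => [|z zr].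
  by rewrite addr_ge0 ?mulr_ge0 ?cmod_ge0.
rewrite !hornerE (le_trans (ler_cmodD _ _)) // lerD2r cmodM ler_pM //.
exact: IH.
Qed.

End Measurability.

(** * Jensen's formula *)

Section Jensen.
Context {K : realType}.
Local Notation C := K[i].
Local Notation mu := (@lebesgue_measure K).
Local Notation u := (@unit_circle K).

Lemma circle_integral_cst (c : K) : circle_integral (fun=> c%:E) = (2 * pi * c)%:E.
Proof.
rewrite /circle_integral integral_cst //= lebesgue_measure_itv /= lte_fin.
by rewrite mulr_gt0 ?pi_gt0 // -EFinD subr0 -EFinM mulrC.
Qed.

Lemma lneM_ge0 (x y : K) : 0 <= x -> 0 <= y ->
  lne (x * y)%:E = (lne x%:E + lne y%:E)%E.
Proof.
move=> x0 y0; have [xz|xN0] := eqVneq x 0.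
  by rewrite xz mul0r /= lexx.
have [yz|yN0] := eqVneq y 0.
  by rewrite yz mulr0 /= lexx; case: ifP.
by rewrite EFinM lneM // in_itv /= leey andbT lte_fin lt_def ?xN0 ?yN0.
Qed.

Lemma lne_le_ln (x c : K) : 0 < c -> x <= c -> (lne x%:E <= (ln c)%:E)%E.
Proof.
move=> c0 xc /=; case: ifPn => [_|]; first exact: leNye.
by rewrite -ltNge => x0; rewrite lee_fin ler_ln.
Qed.

Lemma ln_le_lne (x c : K) : 0 < c -> c <= x -> ((ln c)%:E <= lne x%:E)%E.
Proof.
move=> c0 cx; have x0 := lt_le_trans c0 cx.
by rewrite lne_EFin // lee_fin ler_ln.
Qed.

Lemma cmeasurable_cfactor (w : C) : cmeasurable (fun t => 1 - w * u t).
Proof.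
apply: cmeasurableD; first exact: cmeasurable_cst.
rewrite (_ : (fun t => _) = fun t => (- w) * u t).
  by apply: cmeasurableM; [exact: cmeasurable_cst|exact: cmeasurable_circle].
by apply/funext => t; rewrite mulNr.
Qed.

(** The integrand log |1 - w u(t)| subtracted from its upper bound log 2. For
    |w| <= 1 it is nonnegative, so that the calculus of nonnegative integrals applies
    before integrability is known. *)
Definition log_deficit (w : C) (t : K) : \bar K :=
  ((ln 2)%:E - lne (cmod (1 - w * u t))%:E)%E.

Lemma measurable_log_deficit w : measurable_fun setT (log_deficit w).
Proof.
apply: emeasurable_funB; first exact: measurable_cst.
by apply: measurable_lne; apply: measurable_cmod; exact: cmeasurable_cfactor.
Qed.

Lemma cmod_cfactor w t : cmod (w * u t) = cmod w.
Proof. by rewrite cmodM cmod_circle mulr1. Qed.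

Lemma log_deficit_ge0 w t : cmod w <= 1 -> (0 <= log_deficit w t)%E.
Proof.
move=> w1; rewrite /log_deficit subre_ge0 //; apply: lne_le_ln => //.
by rewrite (le_trans (ler_cmodD _ _)) // cmodN cmod1 cmod_cfactor; lra.
Qed.

Lemma log_deficit_period w t : log_deficit w (t + 2 * pi) = log_deficit w t.
Proof. by rewrite /log_deficit circle_period. Qed.

(** Factor 1 - w^2 u(t)^2 and use u(t + pi) = - u(t). *)
Lemma log_deficit_double w t : cmod w <= 1 ->
  ((ln 2)%:E + log_deficit (w ^+ 2)%R (2 * t)%R =
   log_deficit w t + log_deficit w (t + pi)%R)%E.
Proof.
move=> w1; rewrite /log_deficit.
have -> : u (t + pi) = - u t.
  by rewrite /u cosDpi sinDpi.
have -> : 1 - w ^+ 2 * u (2 * t) = (1 - w * u t) * (1 - w * - u t).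
  by rewrite circleMn; ring.
rewrite cmodM lneM_ge0 //.
set a := lne _; set b := lne _.
have : (a <= (ln 2)%:E)%E.
  apply: lne_le_ln => //.
  by rewrite (le_trans (ler_cmodD _ _)) // cmodN cmod1 cmod_cfactor; lra.
have : (b <= (ln 2)%:E)%E.
  apply: lne_le_ln => //.
  by rewrite mulrN opprK (le_trans (ler_cmodD _ _)) // cmod1 cmod_cfactor; lra.
case: a => [a||]; case: b => [b||] //= _ _.
by rewrite -?EFinN -?EFinD; congr (_%:E); ring.
Qed.

Local Notation G w := (circle_integral (log_deficit w)).

Lemma circle_integral_deficit_double w : cmod w <= 1 ->
  ((2 * pi * ln 2)%:E + G (w ^+ 2)%R = G w + G w)%E.
Proof.
move=> w1; have w2 : cmod (w ^+ 2) <= 1 by rewrite cmodX exprn_ile1.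
have mg := measurable_log_deficit.
rewrite -circle_integral_cst -{1}(@circle_integral_muln _ 2 (log_deficit (w ^+ 2))) //; last 2 first.
- by move=> t; exact: log_deficit_ge0.
- exact: log_deficit_period.
rewrite -{2}(@circle_integral_shift _ pi (log_deficit w)) //; last 3 first.
- by rewrite pi_ge0 /= ler_peMl ?pi_ge0 ?ler1n.
- by move=> t; exact: log_deficit_ge0.
- exact: log_deficit_period.
rewrite /circle_integral -!ge0_integralD //.
- by apply: eq_integral => t _; rewrite log_deficit_double.
all: try by move=> t _; exact: log_deficit_ge0.
all: try by move=> t _; rewrite lee_fin ln_ge0 // ler1n.
all: apply: measurable_funTS => //.
- exact: mg.
- by apply: (measurableT_comp (mg _)); exact: measurable_funD.
- by apply: (measurableT_comp (mg _)); exact: measurable_funM.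
Qed.

(** The difference E(w) of the two sides satisfies 2 E(w) = E(w^2) by doubling. Along
    the orbit w, w^2, w^4, ... it stays bounded, and E(w) is 2^-k times the k-th
    value, hence zero. *)
Lemma circle_integral_deficit_bounded (W : set C) (B : K) :
  (forall w, W w -> cmod w <= 1 /\ W (w ^+ 2)) ->
  (forall w, W w -> (G w <= B%:E)%E) ->
  forall w, W w -> G w = (2 * pi * ln 2)%:E.
Proof.
move=> Wsq WB w Ww; set c := 2 * pi * ln 2.
have c0 : 0 <= c.
  by rewrite /c !mulr_ge0 ?pi_ge0 ?ln_ge0 ?ler1n.
have Gge0 z : W z -> (0 <= G z)%E.
  by move=> /Wsq[z1 _]; apply: integral_ge0 => t _; exact: log_deficit_ge0.
have Gfin z : W z -> exists2 e, G z = e%:E & `|e - c| <= `|B| + c.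
  move=> Wz; have := Gge0 z Wz; have := WB z Wz.
  case: (G z) => [e||] //; rewrite !lee_fin => eB e0.
  exists e => //; rewrite ler_norml; have := ler_norm B; lra.
have key k : forall z, W z -> exists2 e, G z = e%:E & 2 ^+ k * `|e - c| <= `|B| + c.
  elim: k => [|k IH] z Wz.
    by have [e Ge eB] := Gfin z Wz; exists e; rewrite // expr0 mul1r.
  have [z1 Wz2] := Wsq z Wz.
  have [e Ge _] := Gfin z Wz; have [e2 Ge2 e2B] := IH _ Wz2.
  exists e => //; move: (circle_integral_deficit_double z1).
  rewrite Ge Ge2 -!EFinD -/c => -[e2E].
  have -> : e - c = (e2 - c) / 2 by lra.
  rewrite normrM [`|2^-1|]gtr0_norm ?invr_gt0 // exprS.
  by rewrite (_ : _ * _ = 2 ^+ k * `|e2 - c|) //; field.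
have [e Ge _] := Gfin w Ww; rewrite Ge; congr (_%:E).
apply/eqP; rewrite -subr_eq0 -normr_le0 leNgt; apply/negP => d0.
have [k] : exists k, `|B| + c < 2 ^+ k * `|e - c|.
  exists (Num.bound ((`|B| + c) / `|e - c|)).
  rewrite -ltr_pdivrMr //.
  apply: lt_le_trans (archi_boundP _) _; first by rewrite divr_ge0 // addr_ge0.
  by rewrite -natrX ler_nat ltnW // ltn_expl.
rewrite ltNge => /negP; apply.
by have [e'] := key k w Ww; rewrite Ge => -[<-].
Qed.

Lemma circle_integral_deficit_lt1 w : cmod w < 1 -> G w = (2 * pi * ln 2)%:E.
Proof.
move=> w1; pose r := cmod w.
apply: (@circle_integral_deficit_bounded [set z | cmod z <= r]
  (2 * pi * (ln 2 - ln (1 - r)))) => [z zr|z zr|]; last by rewrite /= /r.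
- have z1 : cmod z <= 1 by rewrite (le_trans zr) // ltW.
  split => //=; rewrite cmodX expr2 (le_trans _ zr) // ler_piMr //.
- have z1 : cmod z <= 1 by rewrite (le_trans zr) // ltW.
  rewrite -circle_integral_cst; apply: ge0_le_integral => //.
  + by move=> t _; exact: log_deficit_ge0.
  + by apply: measurable_funTS; exact: measurable_log_deficit.
  move=> t _; rewrite EFinB; apply: leeB => //; apply: ln_le_lne.
    by rewrite subr_gt0.
  by rewrite (le_trans _ (ler_cmodB _ _)) // cmod1 cmod_cfactor lerB.
Qed.

End Jensen.

Section Jensen2.
Context {K : realType}.
Local Notation C := K[i].
Local Notation mu := (@lebesgue_measure K).
Local Notation u := (@unit_circle K).
Local Notation G w := (circle_integral (log_deficit w)).

Lemma cvg_lne (x_ : nat -> K) (x : K) : 0 <= x ->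
  x_ n @[n --> \oo] --> x -> lne (x_ n)%:E @[n --> \oo] --> lne x%:E.
Proof.
rewrite le_eqVlt => /predU1P[<-|x0] xx.
  rewrite [lne 0%:E]/= lexx; apply/cvgeNyPle => A.
  have eA : 0 < expR A by exact: expR_gt0.
  have /cvgrPdist_le /(_ _ eA) := xx; apply: filterS => n.
  rewrite sub0r normrN => xn.
  by rewrite -(expRK A); apply: lne_le_ln => //; rewrite (le_trans (ler_norm _)).
rewrite lne_EFin //.
have pos : \forall n \near \oo, 0 < x_ n.
  have /cvgrPdist_lt /(_ _ x0) := xx; apply: filterS => n.
  by rewrite ltr_norml; lra.
apply: cvg_EFin.
  by apply: filterS pos => n xn; rewrite lne_EFin.
have FF : Filter (\oo : set_system nat) by exact: eventually_filter.
have := @continuous_cvg nat K K \oo FF x_ (@ln K) x (continuous_ln x0) xx.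
apply: cvg_trans; apply: near_eq_cvg.
by apply: filterS pos => n xn; rewrite /= leNgt xn.
Qed.

(** Fatou's lemma for the radii 1 - 1/(k+1), at which the integral is known. It is
    what makes log |1 - w u(t)| integrable across its singularity. *)
Lemma circle_integral_deficit_eq1_le (w : C) : cmod w = 1 ->
  (G w <= (2 * pi * ln 2)%:E)%E.
Proof.
move=> w1; pose w_ k : C := (1 - harmonic k)%:C * w.
have h01 k : 0 < (harmonic k : K) <= 1.
  by rewrite /harmonic /= invr_gt0 ltr0n /= invf_le1 ?ltr0n // ler1n.
have w_lt1 k : cmod (w_ k) < 1.
  have /andP[h0 h1] := h01 k.
  by rewrite cmodM w1 mulr1 cmod_real ger0_norm ?subr_ge0 // ltrBlDr ltrDl.
have lim t : limn_einf (fun k => log_deficit (w_ k) t) = log_deficit w t.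
  apply: (@cvg_limn_einf_sup K _ (log_deficit w t) _).1.
  apply: cvgeB => //; first exact: cvg_cst.
  apply: cvg_lne => //.
  apply/cvgrPdist_le => e e0.
  have /cvgrPdist_le /(_ _ e0) := @cvg_harmonic K.
  apply: filterS => k; rewrite sub0r normrN => ke; apply: le_trans ke.
  have /andP[h0 h1] := h01 k; rewrite [X in _ <= X]ger0_norm ?(ltW h0) //.
  set a := 1 - w * u t; set b := 1 - w_ k * u t.
  have ab : cmod (a - b) = harmonic k.
    have -> : a - b = - ((harmonic k)%:C * w * u t).
      by rewrite /a /b /w_ rmorphB rmorph1; ring.
    by rewrite cmodN !cmodM cmod_circle w1 !mulr1 cmod_real ger0_norm // ltW.
  have ba : cmod (b - a) = harmonic k by rewrite cmodB.
  rewrite ler_norml; have := ler_cmodB a b; have := ler_cmodB b a.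
  rewrite ab ba; lra.
have mD : measurable (`[0%R, (2 * pi)%R] : set (measurableTypeR K)) by [].
have := @fatou _ _ _ mu _ mD (fun k => log_deficit (w_ k))
  (fun k => measurable_funTS (measurable_log_deficit (w_ k)))
  (fun k t _ => log_deficit_ge0 t (ltW (w_lt1 k))).
under eq_integral do rewrite lim.
move=> /le_trans; apply.
under eq_fun do rewrite -/(circle_integral _) circle_integral_deficit_lt1 //.
by rewrite (@cvg_limn_einf_sup K _ (2 * pi * ln 2)%:E _).1 //; exact: cvg_cst.
Qed.

Lemma circle_integral_deficit (w : C) : cmod w <= 1 -> G w = (2 * pi * ln 2)%:E.
Proof.
rewrite le_eqVlt => /predU1P[w1|]; last exact: circle_integral_deficit_lt1.
apply: (@circle_integral_deficit_bounded K [set z | cmod z = 1] (2 * pi * ln 2)) => //= z z1.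
  by rewrite z1 cmodX z1 expr1n.
exact: circle_integral_deficit_eq1_le.
Qed.

Local Notation integrable_circle f := (mu.-integrable `[0%R, (2 * pi)%R] f).

Lemma circle_integrable_cst (c : K) : integrable_circle (fun=> c%:E).
Proof.
apply/integrableP; split; first exact: measurable_cst.
under eq_integral do rewrite /=.
by rewrite -/(circle_integral _) circle_integral_cst ltry.
Qed.

(** Turns the value of the nonnegative integral of c - f into integrability of f,
    and gives its integral. *)
Lemma circle_integrable_deficit (f : K -> \bar K) (c a : K) :
  measurable_fun setT f -> (forall t, f t <= c%:E)%E ->
  circle_integral (fun t => c%:E - f t)%E = a%:E ->
  integrable_circle f /\ circle_integral f = (2 * pi * c - a)%:E.
Proof.
move=> mf fc Ia.
have ig : integrable_circle (fun t => c%:E - f t)%E.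
  apply/integrableP; split.
    by apply: measurable_funTS; apply: emeasurable_funB => //; exact: measurable_cst.
  under eq_integral do rewrite gee0_abs ?subre_ge0 //.
  by rewrite -/(circle_integral _) Ia ltry.
have fE : f = (fun t => c%:E - (c%:E - f t))%E.
  apply/funext => t; rewrite oppeB ?fin_num_adde_defr // addeA subee // add0e //.
rewrite fE; split.
  by apply: integrableB => //; exact: circle_integrable_cst.
rewrite /circle_integral integralB //; last exact: circle_integrable_cst.
by rewrite -!/(circle_integral _) Ia circle_integral_cst.
Qed.

Lemma jensen_cfactor (w : C) : cmod w <= 1 ->
  integrable_circle (fun t => lne (cmod (1 - w * u t))%:E) /\
  circle_integral (fun t => lne (cmod (1 - w * u t))%:E) = 0%:E.
Proof.
move=> w1.
have := @circle_integrable_deficit (fun t => lne (cmod (1 - w * u t))%:E) (ln 2)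
  (2 * pi * ln 2).
rewrite subrr; apply => //.
- by apply: measurable_lne; apply: measurable_cmod; exact: cmeasurable_cfactor.
- by move=> t; rewrite -subre_ge0 //; exact: log_deficit_ge0.
- exact: circle_integral_deficit.
Qed.

(** For |w| <= 1 the factor u - w has the modulus of 1 - conj(w) u on the circle; for
    |w| > 1 take w out and use 1/w. *)
Lemma jensen_factor (w : C) :
  integrable_circle (fun t => lne (cmod (u t - w))%:E) /\
  circle_integral (fun t => lne (cmod (u t - w))%:E) =
    (2 * pi * ln (Num.max 1 (cmod w)))%:E.
Proof.
have [w1|w1] := leP (cmod w) 1.
  have -> : (fun t => lne (cmod (u t - w))%:E) =
     (fun t => lne (cmod (1 - w^*%C * u t))%:E).
    apply/funext => t; congr (lne _%:E).
    rewrite -[in RHS](circle_conj t) [_^*%C * _]mulrC -mulrBr cmodM cmod_circle mul1r.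
    by rewrite -rmorphB cmod_conj.
  by have := @jensen_cfactor w^*%C; rewrite cmod_conj ln1 mulr0; apply.
have w0 : 0 < cmod w by rewrite (lt_trans _ w1).
have wn0 : w != 0 by rewrite -cmod_gt0.
have -> : (fun t => lne (cmod (u t - w))%:E) =
   (fun t => (ln (cmod w))%:E + lne (cmod (1 - w^-1 * u t))%:E)%E.
  apply/funext => t; rewrite -lne_EFin // -lneM_ge0 // -cmodM cmodB.
  by congr (lne (cmod _)%:E); field.
have [|i0 I0] := @jensen_cfactor w^-1.
  by rewrite cmodV invf_le1 // ltW.
split; first by apply: integrableD => //; exact: circle_integrable_cst.
rewrite /circle_integral integralD //; last exact: circle_integrable_cst.
by rewrite -!/(circle_integral _) I0 circle_integral_cst adde0.
Qed.

Lemma jensen (a : C) (ws : seq C) : a != 0 ->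
  let P := a *: \prod_(w <- ws) ('X - w%:P) in
  integrable_circle (fun t => lne (cmod P.[u t])%:E) /\
  circle_integral (fun t => lne (cmod P.[u t])%:E) =
    (2 * pi * ln (cmod a * \prod_(w <- ws) Num.max 1 (cmod w)))%:E.
Proof.
move=> a0 /=; have a0' : 0 < cmod a by rewrite cmod_gt0.
elim: ws => [|w ws [IHi IH]].
  rewrite !big_nil mulr1.
  have -> : (fun t => lne (cmod (a *: 1 : {poly C}).[u t])%:E) = (fun=> (ln (cmod a))%:E).
    by apply/funext => t; rewrite hornerZ hornerC mulr1 lne_EFin.
  by split; [exact: circle_integrable_cst|rewrite circle_integral_cst].
have -> : (fun t => lne (cmod (a *: \prod_(z <- w :: ws) ('X - z%:P)).[u t])%:E) =
  (fun t => lne (cmod (u t - w))%:E +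
     lne (cmod (a *: \prod_(z <- ws) ('X - z%:P)).[u t])%:E)%E.
  apply/funext => t; rewrite -lneM_ge0 // -cmodM big_cons; congr (lne (cmod _)%:E).
  by rewrite !hornerZ hornerM hornerXsubC mulrCA.
have [wi wI] := jensen_factor w.
split; first exact: integrableD.
rewrite /circle_integral integralD // -!/(circle_integral _) wI IH big_cons -EFinD.
have m0 z : 0 < Num.max 1 (cmod z) by rewrite lt_max ltr01.
have q0 : 0 < cmod a * \prod_(z <- ws) Num.max 1 (cmod z) by rewrite mulr_gt0 // prodr_gt0.
congr (_%:E); rewrite -[LHS]mulrDr; congr (_ * _).
by rewrite [in RHS]mulrCA [in RHS]lnM // posrE.
Qed.

End Jensen2.

(** * The geometric mean of a polynomial over the circle *)

Section Mahler.
Context {K : realType}.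
Local Notation C := K[i].
Local Notation mu := (@lebesgue_measure K).
Local Notation u := (@unit_circle K).
Local Notation integrable_circle f := (mu.-integrable `[0%R, (2 * pi)%R] f).
Implicit Types P Q H : {poly C}.

(** The logarithm of the geometric mean times 2 pi, equal to -oo at the zero
    polynomial. *)
Definition log_integral P := circle_integral (fun t => lne (cmod P.[u t])%:E).

Lemma pi2_gt0 : 0 < 2 * pi :> K.
Proof. by rewrite mulr_gt0 // pi_gt0. Qed.

Lemma norm0E P : norm0 P = fine (expeR ((2 * pi)^-1%:E * log_integral P)%E).
Proof. by []. Qed.

Lemma log_integral0 : log_integral 0 = -oo%E.
Proof.
rewrite /log_integral; under eq_fun do rewrite horner0 cmod0 /= lexx.
rewrite /circle_integral integral_cst //= lebesgue_measure_itv /= lte_fin pi2_gt0.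
by rewrite -EFinD subr0 gt0_mulNye // lte_fin pi2_gt0.
Qed.

Lemma norm0_0 : norm0 (0 : {poly C}) = 0.
Proof.
by rewrite norm0E log_integral0 gt0_muleNy // lte_fin invr_gt0 pi2_gt0.
Qed.

Lemma maxprod_gt0 (ws : seq C) : 0 < \prod_(w <- ws) Num.max 1 (cmod w).
Proof. by rewrite prodr_gt0 // => w _; rewrite lt_max ltr01. Qed.

(** Jensen's formula: the geometric mean is the Mahler measure. *)
Lemma norm0_prod (a : C) (ws : seq C) :
  norm0 (a *: \prod_(w <- ws) ('X - w%:P)) = cmod a * \prod_(w <- ws) Num.max 1 (cmod w).
Proof.
have [->|a0] := eqVneq a 0; first by rewrite scale0r norm0_0 cmod0 mul0r.
have [_ I] := jensen ws a0.
rewrite norm0E /log_integral I -EFinM /= mulrA mulVf ?mul1r ?lt0r_neq0 ?pi2_gt0 //.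
by rewrite lnK // posrE mulr_gt0 ?maxprod_gt0 // cmod_gt0.
Qed.

Lemma norm0_ge0 P : 0 <= norm0 P.
Proof.
have [r ->] := closed_field_poly_normal P.
by rewrite norm0_prod mulr_ge0 // ltW // maxprod_gt0.
Qed.

(** Holds for P = 0 too, with both sides equal to -oo, which avoids exceptional
    phases when means over the constant term are taken. *)
Lemma log_integralE P : log_integral P = ((2 * pi)%:E * lne (norm0 P)%:E)%E.
Proof.
have [->|P0] := eqVneq P 0.
  rewrite log_integral0 norm0_0 /= lexx gt0_muleNy // lte_fin pi2_gt0 //.
have [r PE] := closed_field_poly_normal P.
have a0 : lead_coef P != 0 by rewrite lead_coef_eq0.
rewrite PE norm0_prod lne_EFin; last by rewrite mulr_gt0 ?maxprod_gt0 // cmod_gt0.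
by have [_] := jensen r a0; rewrite EFinM.
Qed.

Lemma log_integrable P : P != 0 ->
  integrable_circle (fun t => lne (cmod P.[u t])%:E).
Proof.
move=> P0; have [r PE] := closed_field_poly_normal P.
have a0 : lead_coef P != 0 by rewrite lead_coef_eq0.
by rewrite PE; have [] := jensen r a0.
Qed.

Lemma lne_le (x y : K) : 0 <= x -> x <= y -> (lne x%:E <= lne y%:E)%E.
Proof.
move=> x0 xy; have [y0|y0] := leP y 0.
  by rewrite [lne x%:E]/= (le_trans xy y0) leNye.
by rewrite (lne_EFin y0); exact: lne_le_ln.
Qed.

Lemma norm0_gt0 P : P != 0 -> 0 < norm0 P.
Proof.
move=> P0; have [r ->] := closed_field_poly_normal P.
by rewrite norm0_prod mulr_gt0 ?maxprod_gt0 // cmod_gt0 lead_coef_eq0.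
Qed.

Lemma le_norm0 P Q : (forall t, cmod P.[u t] <= cmod Q.[u t]) ->
  norm0 P <= norm0 Q.
Proof.
move=> PQ; have [->|P0] := eqVneq P 0; first by rewrite norm0_0 norm0_ge0.
have [Q0|Q0] := eqVneq Q 0.
  move: PQ; rewrite Q0 => PQ.
  have : (log_integral P <= log_integral 0)%E.
    rewrite /log_integral (_ : (fun t => _) = fun t => lne (cmod (0 : {poly C}).[u t])%:E) //.
    apply/funext => t; have := PQ t; rewrite horner0 cmod0 => p0.
    by congr (lne _%:E); apply/eqP; rewrite eq_le p0 /=.
  rewrite log_integral0 leeNy_eq log_integralE lne_EFin ?norm0_gt0 //.
have : (log_integral P <= log_integral Q)%E.
  apply: le_integral => //; [exact: log_integrable|exact: log_integrable|].
  by move=> t _; exact: lne_le.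
rewrite !log_integralE !lne_EFin ?norm0_gt0 // -!EFinM lee_fin ler_pM2l ?pi2_gt0 //.
by rewrite ler_ln ?posrE ?norm0_gt0.
Qed.

Lemma norm0Z (c : C) P : norm0 (c *: P) = cmod c * norm0 P.
Proof.
by have [r ->] := closed_field_poly_normal P; rewrite scalerA !norm0_prod cmodM mulrA.
Qed.

Lemma norm0M P Q : norm0 (P * Q) = norm0 P * norm0 Q.
Proof.
have [r ->] := closed_field_poly_normal P; have [s ->] := closed_field_poly_normal Q.
rewrite -scalerAl -scalerAr scalerA -big_cat !norm0_prod big_cat cmodM /=; ring.
Qed.

Lemma norm0X P N : norm0 (P ^+ N) = norm0 P ^+ N.
Proof.
elim: N => [|N IH]; last by rewrite !exprS norm0M IH.
by have := norm0_prod 1 [::]; rewrite !big_nil scale1r cmod1 mulr1 !expr0.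
Qed.

Lemma cmod_horner0_prod (a : C) ws :
  cmod (a *: \prod_(w <- ws) ('X - w%:P)).[0] = cmod a * \prod_(w <- ws) cmod w.
Proof.
rewrite hornerZ cmodM; congr (_ * _).
elim: ws => [|w ws IH]; first by rewrite !big_nil hornerC cmod1.
by rewrite !big_cons hornerM cmodM IH hornerXsubC sub0r cmodN.
Qed.

(** Together with [cmod_horner0_le_norm0], Jensen's formula at the origin: equality
    in |P(0)| <= norm0 P for zero-free P, and a gain by the factor |z0| when there
    is a zero z0 in the disc. *)
Lemma norm0_zero_free P : (forall z, cmod z < 1 -> P.[z] != 0) ->
  norm0 P = cmod P.[0].
Proof.
have [r ->] := closed_field_poly_normal P => Pz.
rewrite norm0_prod cmod_horner0_prod; congr (_ * _).
apply: eq_big_seq => w wr; apply/max_idPr; rewrite leNgt; apply/negP => w1.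
have := Pz w w1; rewrite hornerZ (rootP (_ : root _ w)) ?mulr0 ?eqxx //.
by rewrite root_prod_XsubC.
Qed.

Lemma cmod_horner0_le_norm0 P z0 : cmod z0 < 1 -> P.[z0] = 0 ->
  cmod P.[0] <= cmod z0 * norm0 P.
Proof.
have [->|P0] := eqVneq P 0; first by rewrite !horner0 cmod0 norm0_0 mulr0.
have a0 : lead_coef P != 0 by rewrite lead_coef_eq0.
have [r ->] := closed_field_poly_normal P => z1 /eqP.
rewrite hornerZ mulf_eq0 (negbTE a0) /= => Pz.
have : root (\prod_(w <- r) ('X - w%:P)) z0 by [].
rewrite root_prod_XsubC norm0_prod cmod_horner0_prod => /path.splitPr [s1 s2].
rewrite mulrCA ler_wpM2l // !big_cat !big_cons /= mulrCA ler_wpM2l //.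
rewrite (max_idPl (ltW z1)) mul1r -!big_cat /=.
elim: (s1 ++ s2) => [|w s IH]; first by rewrite !big_nil.
by rewrite !big_cons ler_pM ?prodr_ge0 // le_max lexx orbT.
Qed.

End Mahler.

(** * Operators preserving zero-free polynomials *)

Section Maximum.
Context {K : realType}.
Local Notation C := K[i].
Local Notation u := (@unit_circle K).
Implicit Types F G H P : {poly C}.

Lemma zero_free_discP P :
  zero_free_disc P <-> forall z, cmod z < 1 -> P.[z] != 0.
Proof. by split=> Pz z; have := Pz z; rewrite normr_lt1. Qed.

Lemma cmod_horner0_le_norm0W P : cmod P.[0] <= norm0 P.
Proof.
have [r ->] := closed_field_poly_normal P.
rewrite norm0_prod cmod_horner0_prod ler_wpM2l //.
elim: r => [|w s IH]; first by rewrite !big_nil.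
by rewrite !big_cons ler_pM ?prodr_ge0 // le_max lexx orbT.
Qed.

Lemma exists_expr_lt (x e : K) : 0 <= x < 1 -> 0 < e -> exists N, x ^+ N < e.
Proof.
move=> /andP[x0 x1] e0.
have xlt : `|x| < 1 by rewrite ger0_norm.
have /cvgrPdist_lt /(_ _ e0) [N _ HN] := cvg_expr xlt.
exists N; have := HN N (leqnn N).
by rewrite sub0r normrN ger0_norm // exprn_ge0.
Qed.

(** A maximum principle for G/H. If K = H + eta G vanished at z0, so would
    K_N = H^N - (- eta G)^N for every N. On the circle |K_N| <= (1 + |eta|^N) |H|^N,
    so Jensen's formula, with the gain |z0|, bounds |K_N(0)| by
    |z0| (1 + |eta|^N) |H(0)|^N, although |K_N(0)| >= (1 - |eta|^N) |H(0)|^N. This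
    fails for large N. *)
Lemma zero_free_discD H G (eta : C) : zero_free_disc H ->
  (forall t, cmod G.[u t] <= cmod H.[u t]) -> cmod eta < 1 ->
  zero_free_disc (H + eta *: G).
Proof.
move=> /zero_free_discP Hz GH eta1; apply/zero_free_discP => z0 z01.
apply/negP => /eqP Kz0.
set s := cmod z0 in z01; set rho := cmod eta in eta1.
(* this choice makes s (1 + rho^N) < 1 - rho^N *)
have [N rN] : exists N, rho ^+ N < (1 - s) / 2.
  by apply: exists_expr_lt; [rewrite /rho cmod_ge0|rewrite divr_gt0 // subr_gt0].
pose KN := H ^+ N - (- eta *: G) ^+ N.
have KNz : KN.[z0] = 0.
  rewrite /KN hornerD hornerN !horner_exp hornerZ.
  have -> : H.[z0] = - eta * G.[z0].
    by apply/eqP; rewrite mulNr -addr_eq0; apply/eqP; rewrite -Kz0 !hornerE.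
  by rewrite subrr.
have H0 : 0 < cmod H.[0] by rewrite cmod_gt0 Hz // cmod0.
have nH : norm0 H = cmod H.[0] by apply: norm0_zero_free.
have G0 : cmod G.[0] <= cmod H.[0].
  by rewrite -nH (le_trans (cmod_horner0_le_norm0W _)) // le_norm0.
have r0 : 0 <= rho ^+ N by rewrite exprn_ge0 // cmod_ge0.
have nK : norm0 KN <= (1 + rho ^+ N) * cmod H.[0] ^+ N.
  have -> : (1 + rho ^+ N) * cmod H.[0] ^+ N = norm0 ((1 + rho ^+ N)%:C *: H ^+ N).
    by rewrite norm0Z cmod_real norm0X nH ger0_norm // addr_ge0.
  apply: le_norm0 => t.
  rewrite /KN hornerD hornerN hornerZ !horner_exp hornerZ (le_trans (ler_cmodD _ _)) //.
  rewrite cmodN !cmodM !cmodX cmodM cmod_real cmodN ger0_norm ?addr_ge0 //.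
  rewrite mulrDl mul1r lerD2l exprMn ler_wpM2l // lerXn2r ?nnegrE //.
have K0 : (1 - rho ^+ N) * cmod H.[0] ^+ N <= cmod KN.[0].
  rewrite /KN hornerD hornerN !horner_exp hornerZ (le_trans _ (ler_cmodB _ _)) //.
  rewrite !cmodX cmodM cmodN -/rho mulrBl mul1r lerB // exprMn ler_wpM2l //.
  by rewrite lerXn2r ?nnegrE.
have := le_trans K0 (le_trans (cmod_horner0_le_norm0 z01 KNz)
   (ler_wpM2l (cmod_ge0 z0) nK)).
rewrite mulrA ler_pM2r ?exprn_gt0 // -/s => ineq.
have s0 : 0 <= s by exact: cmod_ge0.
have : s * rho ^+ N <= rho ^+ N by rewrite ler_piMl // ltW.
by lra.
Qed.

Lemma lipschitz_horner P : exists2 L : K, 0 <= L &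
  forall z w, cmod z <= 1 -> cmod w <= 1 -> cmod (P.[z] - P.[w]) <= L * cmod (z - w).
Proof.
elim/poly_ind: P => [|P c [L L0 IH]].
  by exists 0 => // z w _ _; rewrite !horner0 subrr cmod0 mul0r.
have [M M0 PM] := bounded_horner P 1.
exists (M + L); first by rewrite addr_ge0.
move=> z w z1 w1; rewrite !hornerE.
have -> : P.[z] * z + c - (P.[w] * w + c) = P.[z] * (z - w) + (P.[z] - P.[w]) * w by ring.
rewrite (le_trans (ler_cmodD _ _)) // !cmodM mulrDl lerD //.
  by rewrite ler_wpM2r // PM.
by rewrite (le_trans (ler_piMr _ w1)) // IH.
Qed.

(** Polynomials are Lipschitz on the closed disc, so that the inequality passes from
    radius 1 - d to the circle with an error O(d). *)
Lemma le_cmod_circle F G : (forall z, cmod z < 1 -> cmod F.[z] <= cmod G.[z]) ->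
  forall t, cmod F.[u t] <= cmod G.[u t].
Proof.
move=> FG t; apply/ler_addgt0Pr => e e0.
have [L L0 FL] := lipschitz_horner F; have [M M0 GM] := lipschitz_horner G.
(* the radius 1 - d costs at most (L + M) d <= e *)
pose d := Num.min 1 (e / (L + M + 1)).
have LM : 0 < L + M + 1 by lra.
have d0 : 0 < d by rewrite lt_min ltr01 divr_gt0.
have d1 : d <= 1 by rewrite ge_min lexx.
have de : (L + M) * d <= e.
  have : d * (L + M + 1) <= e by rewrite -ler_pdivlMr // ge_min lexx orbT.
  by nra.
pose z := (1 - d)%:C * u t.
have cz : cmod z = 1 - d by rewrite cmodM cmod_circle mulr1 cmod_real ger0_norm // subr_ge0.
have cu : cmod (u t) <= 1 by rewrite cmod_circle.
have z1 : cmod z <= 1 by rewrite cz; lra.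
have uz : cmod (u t - z) = d.
  have -> : u t - z = d%:C * u t by rewrite /z rmorphB rmorph1; ring.
  by rewrite cmodM cmod_circle mulr1 cmod_real ger0_norm // ltW.
have zu : cmod (z - u t) = d by rewrite cmodB.
have := FL _ _ cu z1; have := GM _ _ z1 cu; rewrite uz zu.
have := ler_cmodB F.[u t] F.[z]; have := ler_cmodB G.[z] G.[u t].
have : cmod F.[z] <= cmod G.[z] by apply: FG; rewrite cz; lra.
rewrite [cmod (G.[z] - _)]cmodB; lra.
Qed.

(** The degree bound n matters: the operators at hand depend on n, and polynomials of
    lower degree are regarded as having zeros at infinity. *)
Definition zero_free_preserver n (s0 : C) (S : {poly C} -> {poly C}) :=
  [/\ forall F G (eta : C), S (F + eta *: G) = S F + eta *: S G,
      S 1 = s0%:P,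
      forall F, (S F).[0] = s0 * F.[0]
    & forall F, (size F <= n.+1)%N -> zero_free_disc F -> zero_free_disc (S F)].

(** Otherwise S (G + eta F) would vanish in the disc for some |eta| < 1, although
    G + eta F is zero-free. *)
Lemma preserver_dominates n s0 S F G : zero_free_preserver n s0 S ->
  (size F <= n.+1)%N -> (size G <= n.+1)%N -> zero_free_disc G ->
  (forall t, cmod F.[u t] <= cmod G.[u t]) ->
  forall z, cmod z < 1 -> cmod (S F).[z] <= cmod (S G).[z].
Proof.
move=> [lin _ _ pres] sF sG Gz FG z z1; rewrite leNgt; apply/negP => lt.
have F0 : 0 < cmod (S F).[z] by rewrite (le_lt_trans _ lt).
have SF0 : (S F).[z] != 0 by rewrite -cmod_gt0.
(* the value of eta for which S G + eta S F vanishes at z *)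
pose eta := - (S G).[z] / (S F).[z].
have eta1 : cmod eta < 1 by rewrite cmodM cmodN cmodV ltr_pdivrMr // mul1r.
have : zero_free_disc (S (G + eta *: F)).
  apply: pres; last exact: zero_free_discD.
  by rewrite (leq_trans (size_polyD _ _)) // geq_max sG (leq_trans (size_scale_leq _ _)).
move/zero_free_discP => /(_ z z1); rewrite lin !hornerE /eta.
by rewrite divfK // subrr eqxx.
Qed.

(** Replace each factor X - w with |w| < 1 by 1 - conj(w) X, which has the same
    modulus on the circle. *)
Lemma exists_zero_free_majorant F : F != 0 ->
  exists G, [/\ (size G <= size F)%N, zero_free_disc G
     & forall t, cmod G.[u t] = cmod F.[u t]].
Proof.
have [r FE] := closed_field_poly_normal F => F0.
have a0 : lead_coef F != 0 by rewrite lead_coef_eq0.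
rewrite FE size_scale // size_prod_XsubC.
elim: r {FE} => [|w r [G [sG Gz GE]]].
  exists (lead_coef F)%:P; split=> [|z _|t].
  - by rewrite size_polyC a0.
  - by rewrite hornerC.
  - by rewrite big_nil hornerZ !hornerC mulr1.
pose L : {poly C} := if cmod w < 1 then 1 - w^*%C *: 'X else 'X - w%:P.
have sL : (size L <= 2)%N.
  rewrite /L; case: ifP => _; last by rewrite size_XsubC.
  rewrite (leq_trans (size_polyD _ _)) // size_poly1 size_polyN geq_max /=.
  by rewrite (leq_trans (size_scale_leq _ _)) // size_polyX.
exists (L * G); split.
- rewrite (leq_trans (size_polyMleq _ _)) //= -subn1 leq_subLR.
  by rewrite (leq_trans (leq_add sL sG)).
- apply/zero_free_discP => z z1; rewrite hornerM mulf_neq0 //; last first.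
    by move/zero_free_discP : Gz; apply.
  rewrite /L; case: ifPn => w1; rewrite !hornerE.
    apply: contraTneq z1 => /eqP; rewrite subr_eq0 => /eqP wz.
    rewrite -leNgt -[leLHS](@cmod1 K) wz cmodM cmod_conj ler_piMl // ltW //.
  apply: contraNneq w1 => /eqP; rewrite subr_eq0 => /eqP <-; exact: z1.
move=> t; rewrite big_cons !hornerM cmodM GE !hornerZ hornerM !cmodM mulrCA; congr (_ * (_ * _)).
rewrite /L; case: ifP => _; rewrite !hornerE //.
rewrite -(circle_conj t) [_^*%C * _]mulrC -mulrBr cmodM cmod_circle mul1r.
by rewrite -rmorphB cmod_conj.
Qed.

(** Arestov's inequality for p = 0. For a zero-free majorant G of F, S G is a zero-free
    majorant of S F, and its geometric mean is |S G (0)| = |s0 G(0)|. *)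
Lemma preserver_norm0 n s0 S F : zero_free_preserver n s0 S ->
  (size F <= n.+1)%N -> norm0 (S F) <= cmod s0 * norm0 F.
Proof.
move=> pS sF; have [F0|F0] := eqVneq F 0.
  suff -> : S F = 0 by rewrite norm0_0 mulr_ge0 // norm0_ge0.
  case: pS => lin _ _ _; have := lin 0 0 1; rewrite scaler0 addr0 scale1r F0 => S0.
  by apply: (addrI (S 0)); rewrite addr0 -S0.
have [G [sG Gz GE]] := exists_zero_free_majorant F0.
have sGn := leq_trans sG sF.
have GF : norm0 G = norm0 F.
  by apply/eqP; rewrite eq_le !le_norm0 // => t; rewrite GE.
have /zero_free_discP SGz : zero_free_disc (S G) by case: pS => _ _ _; apply.
rewrite -GF [norm0 G]norm0_zero_free; last exact/zero_free_discP.
have <- : norm0 (S G) = cmod s0 * cmod G.[0].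
  by rewrite norm0_zero_free //; case: pS => _ _ -> _; rewrite cmodM.
apply: le_norm0; apply: le_cmod_circle.
by apply: (preserver_dominates pS) => // t; rewrite GE.
Qed.

End Maximum.

(** * Iterated integrals *)

Section Tonelli.
Context {K : realType}.
Local Notation mu := (@lebesgue_measure K).
Local Notation KK := (measurableTypeR K * measurableTypeR K)%type.

(** Tonelli's theorem over subsets, by extending the integrand by zero. *)
Lemma tonelli_in (D E : set (measurableTypeR K)) (F : K -> K -> \bar K) :
  measurable D -> measurable E ->
  measurable_fun [set: KK] (fun z : KK => F z.1 z.2) ->
  (forall x y, 0 <= F x y)%E ->
  (\int[mu]_(x in D) \int[mu]_(y in E) F x y =
   \int[mu]_(y in E) \int[mu]_(x in D) F x y)%E.
Proof.
move=> mD mE mF F0.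
pose F' (z : KK) := if (z.1 \in D) && (z.2 \in E) then F z.1 z.2 else 0%E.
have mF' : measurable_fun [set: KK] F'.
  apply: measurable_fun_ifT; [|exact: mF|exact: measurable_cst].
  apply: measurable_and.
  - apply: (@measurable_fun_bool _ _ _ _ true).
    rewrite (_ : _ @^-1` _ = D `*` setT) ?setTI //; last first.
      by apply/seteqP; split=> -[x y] /= => [/set_mem|[] *]; do ?[split|exact: mem_set].
    exact: measurableX.
  - apply: (@measurable_fun_bool _ _ _ _ true).
    rewrite (_ : _ @^-1` _ = setT `*` E) ?setTI //; last first.
      by apply/seteqP; split=> -[x y] /= => [/set_mem|[] *]; do ?[split|exact: mem_set].
    exact: measurableX.
have F'0 z : (0 <= F' z)%E by rewrite /F'; case: ifP.
have := @fubini_tonelli _ _ _ _ K mu mu F' mF' F'0.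
rewrite [in X in _ -> X = _]integral_mkcond [in X in _ -> _ = X]integral_mkcond.
congr (_ = _); apply: eq_integral => x _; rewrite /patch.
  case: ifPn => xD; last by apply: integral0_eq => y _; rewrite /F' /= (negbTE xD).
  rewrite [RHS]integral_mkcond; apply: eq_integral => y _.
  by rewrite /F' /patch /= xD.
case: ifPn => xD; last by apply: integral0_eq => y _; rewrite /F' /= (negbTE xD) andbF.
rewrite [RHS]integral_mkcond; apply: eq_integral => y _.
by rewrite /F' /patch /= xD andbT.
Qed.

Lemma measurable_integral_in (D : set (measurableTypeR K)) (F : K -> K -> \bar K) :
  measurable D -> measurable_fun [set: KK] (fun z : KK => F z.1 z.2) ->
  (forall x y, 0 <= F x y)%E ->
  measurable_fun [set: measurableTypeR K] (fun y : measurableTypeR K => \int[mu]_(x in D) F x y)%E.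
Proof.
move=> mD mF F0.
pose F' (z : KK) := if z.1 \in D then F z.1 z.2 else 0%E.
have mF' : measurable_fun [set: KK] F'.
  apply: measurable_fun_ifT; [|exact: mF|exact: measurable_cst].
  apply: (@measurable_fun_bool _ _ _ _ true).
  rewrite (_ : _ @^-1` _ = D `*` setT) ?setTI //; last first.
    by apply/seteqP; split=> -[x y] /= => [/set_mem|[] *]; do ?[split|exact: mem_set].
  exact: measurableX.
have F'0 z : (0 <= F' z)%E by rewrite /F'; case: ifP.
have := @measurable_fun_fubini_tonelli_G _ _ _ _ K mu F' mF' F'0.
congr (measurable_fun _ _); apply/funext => y.
rewrite [RHS]integral_mkcond; apply: eq_integral => x _.
by rewrite /F' /patch /=.
Qed.

End Tonelli.

(** * Powers as integrals of logarithms *)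

Section LogKernel.
Context {K : realType}.
Local Notation mu := (@lebesgue_measure K).
Implicit Types p x s : K.

(** The function log^+ (x / c) for c = exp (- s). *)
Definition log_kernel x s := ln (Num.max x (expR (- s))) + s.

Lemma log_kernel_ge0 x s : 0 <= log_kernel x s.
Proof.
rewrite /log_kernel -lerBlDr sub0r -{1}(expRK (- s)) ler_ln ?posrE ?expR_gt0 //.
  by rewrite le_max lexx orbT.
by rewrite lt_max expR_gt0 orbT.
Qed.

Lemma log_kernel0 s : log_kernel 0 s = 0.
Proof. by rewrite /log_kernel (max_idPr (expR_ge0 _)) expRK addNr. Qed.

Lemma log_kernel1 s : log_kernel 1 s = Num.max 0 s.
Proof.
rewrite /log_kernel; have [s0|s0] := leP 0 s.
  by rewrite (max_idPl _) ?ln1 ?add0r // expR_le1 oppr_le0.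
by rewrite (max_idPr _) ?expRK ?addNr // -expR0 ler_expR oppr_ge0 ltW.
Qed.

Lemma log_kernel_scale x s : 0 < x -> log_kernel x s = log_kernel 1 (s + ln x).
Proof.
move=> x0; rewrite /log_kernel addrA -[in LHS](lnK x0).
have -> : Num.max (expR (ln x)) (expR (- s)) =
    expR (ln x) * Num.max 1 (expR (- (s + ln x))).
  by rewrite maxr_pMr ?expR_ge0 // mulr1 -expRD; congr (Num.max _ (expR _)); ring.
rewrite lnM ?posrE ?expR_gt0 // ?lt_max ?ltr01 // expRK; ring.
Qed.

Lemma measurable_log_kernel d (T : measurableType d) (f g : T -> K) :
  measurable_fun setT f -> measurable_fun setT g ->
  measurable_fun setT (fun t => log_kernel (f t) (g t)).
Proof.
move=> mf mg; apply: measurable_funD => //.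
apply: (measurableT_comp (@measurable_ln K)).
apply: measurable_maxr => //.
by apply: (measurableT_comp (@measurable_expR K)); exact: measurable_funN.
Qed.

Lemma cvgr_mulexpR p : 0 < p ->
  (s / p + p ^- 2) * expR (- (p * s)) @[s --> +oo] --> (0 : K).
Proof.
move=> p0.
apply: (@squeeze_cvgr K +oo _ K (fun=> 0) (fun s => 2 * p ^- 2 * expR (- (p / 2 * s)))).
- near=> s; have s0 : 0 <= s by near: s; apply: nbhs_pinfty_ge; rewrite num_real.
  rewrite mulr_ge0 ?addr_ge0 ?divr_ge0 ?invr_ge0 ?exprn_ge0 ?expR_ge0 ?(ltW p0) //=.
  have -> : - (p * s) = - (p / 2 * s) + - (p / 2 * s) by field.
  rewrite expRD mulrA ler_wpM2r ?expR_ge0 //.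
  have e0 := expR_gt0 (p / 2 * s).
  rewrite expRN ler_pdivrMr // (_ : s / p + p ^- 2 = p ^- 2 * (1 + p * s)); last first.
    by field; rewrite gt_eqF.
  rewrite (_ : 2 * _ * _ = p ^- 2 * (2 * expR (p / 2 * s))); last by ring.
  rewrite ler_wpM2l ?invr_ge0 ?exprn_ge0 ?(ltW p0) //.
  by have := expR_ge1Dx (p / 2 * s); lra.
- exact: cvg_cst.
- rewrite -[X in _ --> X](mulr0 (2 * p ^- 2)); apply: cvgMr.
  have h : p / 2 * s @[s --> +oo] --> +oo.
    by apply: gt0_cvgMry; [rewrite divr_gt0|exact: cvg_id].
  exact: (cvg_comp _ _ h (@cvgr_expR K)).
Unshelve. all: by end_near. Qed.

(** The primitive of s exp (- p s) is - (s / p + p^-2) exp (- p s). *)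
Lemma integral_log_kernel1 p : 0 < p ->
  (\int[mu]_(s in [set: K]) (expR (- (p * s)) * log_kernel 1 s)%:E = (p ^- 2)%:E)%E.
Proof.
move=> p0; pose F s := - ((s / p + p ^- 2) * expR (- (p * s))).
have dF s : is_derive s 1 F (s * expR (- (p * s))).
  rewrite /F; apply: is_derive_eq.
  rewrite !scaler1 /GRing.scale /=; field; rewrite gt_eqF //.
have cF s : {for s, continuous F}.
  by apply/differentiable_continuous/derivable1_diffP.
have cf : continuous (fun s => s * expR (- (p * s))).
  move=> s; apply: cvgM; first exact: cvg_id.
  apply: (continuous_comp (f := fun s => - (p * s)) (g := expR)); last exact: continuous_expR.
  by apply: cvgN; apply: cvgMr; exact: cvg_id.
have := @ge0_continuous_FTC2y K (fun s => s * expR (- (p * s))) F 0 0.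
move=> H; transitivity (\int[mu]_(s in `[0%R, +oo[) (s * expR (- (p * s)))%:E)%E.
  rewrite [RHS]integral_mkcond; apply: eq_integral => s _.
  rewrite log_kernel1 /patch mem_setE in_itv /= andbT.
  have [s0|s0] := leP 0 s; first by rewrite mulrC.
  by rewrite mulr0.
rewrite H.
- by rewrite /F !mul0r !add0r mulr0 oppr0 expR0 mulr1 -EFinN opprK.
- by move=> s s0; rewrite mulr_ge0 // expR_ge0.
- by apply: continuous_subspaceT.
- by rewrite -oppr0; apply: cvgN; exact: cvgr_mulexpR.
- by move=> s _.
- by apply: cvg_at_right_filter; exact: cF.
- by move=> s _; rewrite derive1E derive_val.
Qed.

(** Layer-cake formula for the power x^p, by translation invariance: replacing 1 by x
    shifts s by ln x, and exp (- p s) then contributes the factor x^p. *)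
Lemma integral_log_kernel p x : 0 < p -> 0 <= x ->
  (\int[mu]_(s in [set: K]) (expR (- (p * s)) * log_kernel x s)%:E =
   (p ^- 2 * x `^ p)%:E)%E.
Proof.
move=> p0; rewrite le_eqVlt => /predU1P[<-|x0].
  rewrite powR0 ?gt_eqF // mulr0; apply: integral0_eq => s _.
  by rewrite log_kernel0 mulr0.
pose g s := (expR (- (p * s)) * log_kernel 1 s)%:E.
have mg : measurable_fun [set: K] g.
  apply/measurable_EFinP; apply: measurable_funM.
    by apply: (measurableT_comp (@measurable_expR K)); apply: measurable_funN; exact: measurable_funM.
  by apply: measurable_log_kernel => //; exact: measurable_cst.
have g0 s : (0 <= g s)%E by rewrite lee_fin mulr_ge0 ?expR_ge0 ?log_kernel_ge0.
have -> : (fun s => (expR (- (p * s)) * log_kernel x s)%:E) =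
    (fun s => (x `^ p)%:E * g (1 * s + ln x)%R)%E.
  apply/funext => s; rewrite /g mul1r -EFinM mulrA log_kernel_scale //; congr ((_ * _)%:E).
  rewrite /powR gt_eqF // -expRD; congr expR; ring.
rewrite ge0_integralZl //; last 2 first.
- by apply: (measurableT_comp mg); apply: measurable_funD => //; exact: measurable_funM.
- by rewrite lee_fin powR_ge0.
have := @ge0_integral_affine K 1 (ln x) setT g ltr01 measurableT mg g0.
rewrite mul1e preimage_setT => <-.
by rewrite integral_log_kernel1 // -EFinM mulrC.
Qed.

End LogKernel.

(** * Arestov's inequality *)

Section Arestov.
Context {K : realType}.
Local Notation C := K[i].
Local Notation mu := (@lebesgue_measure K).
Local Notation u := (@unit_circle K).
Local Notation KK := (measurableTypeR K * measurableTypeR K)%type.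
Implicit Types P Q F : {poly C}.

(** The only zero is - a / b. *)
Lemma norm0_linear (a b : C) : norm0 (a%:P + b *: 'X) = Num.max (cmod a) (cmod b).
Proof.
have [->|b0] := eqVneq b 0.
  rewrite scale0r addr0 cmod0 (max_idPl (cmod_ge0 _)).
  by have := norm0_prod a [::]; rewrite !big_nil mulr1 alg_polyC.
have := norm0_prod b [:: - (a / b)].
rewrite !big_seq1 rmorphN opprK scalerDr /= -[(a / b)%:P]alg_polyC scalerA.
rewrite mulrC divfK // alg_polyC addrC => ->.
rewrite maxr_pMr // mulr1 maxC cmodN cmodM cmodV mulrC divfK // cmod_eq0 //.
Qed.

Lemma circle_integral_horner_deficit P (c : K) :
  circle_integral (fun t => c%:E - lne (cmod P.[u t])%:E)%E =
  ((2 * pi * c)%:E - log_integral P)%E.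
Proof.
have [->|P0] := eqVneq P 0.
  rewrite log_integral0 /=; under eq_fun do rewrite horner0 cmod0 /= lexx.
  rewrite /circle_integral integral_cst //= lebesgue_measure_itv /= lte_fin pi2_gt0.
  by rewrite -EFinD subr0 gt0_mulye // lte_fin pi2_gt0.
rewrite /circle_integral integralB //.
- by rewrite -!/(circle_integral _) circle_integral_cst.
- exact: circle_integrable_cst.
- exact: log_integrable.
Qed.

Lemma circle_integral_linear_deficit (a b : C) (c : K) : b != 0 ->
  circle_integral (fun t => c%:E - lne (cmod (a + b * u t))%:E)%E =
  (2 * pi * (c - ln (Num.max (cmod a) (cmod b))))%:E.
Proof.
move=> b0; have := circle_integral_horner_deficit (a%:P + b *: 'X) c.
rewrite log_integralE norm0_linear lne_EFin; last by rewrite lt_max [0 < cmod b]cmod_gt0 b0 orbT.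
rewrite -EFinM -EFinB -mulrBr => <-.
by congr circle_integral; apply/funext => t; rewrite !hornerE.
Qed.

Lemma measurable_cmod_horner P d (T : measurableType d) (f : T -> K) :
  measurable_fun setT f -> measurable_fun setT (fun t => cmod P.[u (f t)]).
Proof.
move=> mf; apply: measurable_cmod; apply: cmeasurable_horner; exact: cmeasurable_circle.
Qed.

Section Average.
Context (Q : {poly C}) (b : C) (c : K) (b0 : b != 0)
  (Qc : forall t, cmod Q.[u t] + cmod b <= expR c).

Let D (theta gamma : K) := (c%:E - lne (cmod (Q.[u theta] + b * u gamma))%:E)%E.

Lemma deficit2_ge0 theta gamma : (0 <= D theta gamma)%E.
Proof.
rewrite /D subre_ge0 // -[c in leRHS]expRK; apply: lne_le_ln; first exact: expR_gt0.
by rewrite (le_trans (ler_cmodD _ _)) // cmodM cmod_circle mulr1.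
Qed.

Lemma measurable_deficit2 : measurable_fun [set: KK] (fun z : KK => D z.1 z.2).
Proof.
apply: emeasurable_funB; first exact: measurable_cst.
apply: measurable_lne; apply: measurable_cmod; apply: cmeasurableD.
  by apply: cmeasurable_horner; apply: cmeasurable_circle; exact: measurable_fst.
apply: cmeasurableM; first exact: cmeasurable_cst.
by apply: cmeasurable_circle; exact: measurable_snd.
Qed.

(** Averaging over the phase gamma of the constant term b u(gamma) replaces
    log |Q + b u(gamma)| by log max(|Q|, |b|). *)
Lemma circle_integral2_deficit :
  circle_integral (fun gamma => circle_integral (fun theta => D theta gamma)) =
  circle_integral (fun theta =>
    (2 * pi * (c - ln (Num.max (cmod Q.[u theta]) (cmod b))))%:E).
Proof.
rewrite /circle_integral -(@tonelli_in K `[0, 2 * pi] `[0, 2 * pi] D) //.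
- apply: eq_integral => theta _.
  by rewrite -[LHS]/(circle_integral _) circle_integral_linear_deficit.
- exact: measurable_deficit2.
- exact: deficit2_ge0.
Qed.

Lemma measurable_circle_integral_deficit :
  measurable_fun [set: measurableTypeR K]
    (fun gamma => circle_integral (fun theta => D theta gamma)).
Proof.
apply: measurable_integral_in => //; [exact: measurable_deficit2|exact: deficit2_ge0].
Qed.

End Average.


Lemma size_addC F (c : C) n : (size F <= n.+1)%N -> (size (F + c%:P)%R <= n.+1)%N.
Proof.
move=> sF; rewrite (leq_trans (size_polyD _ _)) // geq_max sF.
by rewrite (leq_trans (size_polyC_leq1 _)).
Qed.

Lemma preserver_neq0 n s0 (S : {poly C} -> {poly C}) :
  zero_free_preserver n s0 S -> s0 != 0.
Proof.
case=> _ S1 _ pres.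
have /zero_free_discP /(_ 0) : zero_free_disc (S 1).
  by apply: pres; [rewrite size_poly1|move=> z _; rewrite hornerC oner_neq0].
by rewrite cmod0 ltr01 S1 hornerC; apply.
Qed.

Lemma preserver_addC n s0 (S : {poly C} -> {poly C}) F (c : C) :
  zero_free_preserver n s0 S -> S (F + c%:P) = S F + (s0 * c)%:P.
Proof.
by case=> lin S1 _ _; rewrite -alg_polyC lin S1 -[(s0 * c)%:P]alg_polyC
  -[s0%:P]alg_polyC scalerA mulrC.
Qed.

Lemma circle_integral_compl (f : K -> K) (c : K) :
  measurable_fun setT f -> (forall t, 0 <= f t) -> (forall t, f t <= c) ->
  (circle_integral (fun t => (f t)%:E) + circle_integral (fun t => (c - f t)%:E) =
   (2 * pi * c)%:E)%E.
Proof.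
move=> mf f0 fc; rewrite /circle_integral -ge0_integralD //.
- rewrite -circle_integral_cst; apply: eq_integral => t _.
  by rewrite -EFinD addrC subrK.
- by move=> t _; rewrite lee_fin.
- by apply/measurable_funTS/measurable_EFinP.
- by move=> t _; rewrite lee_fin subr_ge0.
- apply/measurable_funTS/measurable_EFinP.
  by apply: measurable_funB => //; exact: measurable_cst.
Qed.

Section Preserver.
Context (n : nat) (s0 : C) (S : {poly C} -> {poly C}) (F : {poly C}).
Context (pS : zero_free_preserver n s0 S) (sF : (size F <= n.+1)%N).

(** The case p = 0 of the inequality for F + c, written so that it remains meaningful
    when F + c = 0. *)
Lemma deficit_preserver (c : C) (k : K) :
  (circle_integral (fun t => k%:E - lne (cmod (F.[u t] + c))%:E) <=
   circle_integral (fun t => (ln (cmod s0) + k)%:E - lne (cmod ((S F).[u t] + s0 * c))%:E))%E.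
Proof.
have s0n := preserver_neq0 pS.
have -> : (fun t => k%:E - lne (cmod (F.[u t] + c))%:E)%E =
   (fun t => k%:E - lne (cmod (F + c%:P).[u t])%:E)%E.
  by apply/funext => t; rewrite hornerD hornerC.
have -> : (fun t => (ln (cmod s0) + k)%:E - lne (cmod ((S F).[u t] + s0 * c))%:E)%E =
   (fun t => (ln (cmod s0) + k)%:E - lne (cmod (S (F + c%:P)).[u t])%:E)%E.
  by apply/funext => t; rewrite (preserver_addC _ _ pS) hornerD hornerC.
rewrite !circle_integral_horner_deficit !log_integralE.
have : (lne (norm0 (S (F + c%:P)))%:E <=
    (ln (cmod s0))%:E + lne (norm0 (F + c%:P))%:E)%E.
  rewrite -lne_EFin ?cmod_gt0 // -lneM_ge0 ?norm0_ge0 //.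
  apply: lne_le; first exact: norm0_ge0.
  by apply: (preserver_norm0 pS); exact: size_addC.
have p2 := @pi2_gt0 K.
have: (lne (norm0 (S (F + c%:P)))%:E != +oo)%E by rewrite /lne; case: ifP.
have: (lne (norm0 (F + c%:P))%:E != +oo)%E by rewrite /lne; case: ifP.
case: (lne _) => [x||] //; case: (lne _) => [y||] // _ _.
- rewrite -EFinD lee_fin => yx; rewrite -!EFinM -!EFinB lee_fin.
  have : 2 * pi * y <= 2 * pi * (ln (cmod s0) + x) by rewrite ler_pM2l.
  lra.
- by rewrite gt0_muleNy ?lte_fin //= leey.
- by rewrite !gt0_muleNy ?lte_fin.
Qed.

(** [deficit_preserver] with constant term c u(gamma), averaged over gamma. *)
Lemma log_kernel_preserver s :
  (circle_integral (fun t => (log_kernel (cmod (S F).[u t] / cmod s0) s)%:E) <=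
   circle_integral (fun t => (log_kernel (cmod F.[u t]) s)%:E))%E.
Proof.
have s0n := preserver_neq0 pS.
have s0p : 0 < cmod s0 by rewrite cmod_gt0.
have [B1 B10 FB] := bounded_horner F 1; have [B2 B20 SB] := bounded_horner (S F) 1.
pose c := expR (- s); have c0 : 0 < c by exact: expR_gt0.
have M0 : 0 < B1 + B2 / cmod s0 + c.
  by rewrite ltr_wpDl // addr_ge0 // divr_ge0.
(* an upper bound of log max(|F|, c) and log max(|S F| / |s0|, c) *)
pose k := ln (B1 + B2 / cmod s0 + c).
have ek : expR k = B1 + B2 / cmod s0 + c by rewrite lnK.
have cc : cmod (c%:C : C) = c by rewrite cmod_real gtr0_norm.
have cn : (c%:C : C) != 0 by rewrite -cmod_gt0 cc.
have scn : s0 * c%:C != 0 by rewrite mulf_neq0.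
have cu t : cmod (u t) <= 1 by rewrite cmod_circle.
have Fk t : cmod F.[u t] + cmod (c%:C : C) <= expR k.
  by rewrite ek cc lerD2r (le_trans (FB _ (cu t))) // lerDl divr_ge0.
have Sk t : cmod (S F).[u t] + cmod (s0 * c%:C) <= expR (ln (cmod s0) + k).
  rewrite expRD lnK // ek cmodM cc mulrDr lerD2r mulrDr.
  by rewrite [_ * (B2 / _)]mulrC divfK ?gt_eqF // ler_wpDl ?mulr_ge0 // SB.
have : (circle_integral (fun g => circle_integral (fun t =>
           k%:E - lne (cmod (F.[u t] + c%:C * u g))%:E)) <=
         circle_integral (fun g => circle_integral (fun t =>
           (ln (cmod s0) + k)%:E - lne (cmod ((S F).[u t] + s0 * c%:C * u g))%:E)))%E.
  apply: ge0_le_integral => //.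
  - by move=> g _; apply: integral_ge0 => t _; exact: deficit2_ge0.
  - by apply: measurable_funTS; exact: measurable_circle_integral_deficit.
  - by apply: measurable_funTS; exact: measurable_circle_integral_deficit.
  - by move=> g _; rewrite -(mulrA s0); exact: deficit_preserver.
rewrite !circle_integral2_deficit // cc.
pose f t := 2 * pi * log_kernel (cmod (S F).[u t] / cmod s0) s.
pose g t := 2 * pi * log_kernel (cmod F.[u t]) s.
have p2 := @pi2_gt0 K.
rewrite (_ : (fun t => _) = fun t => (2 * pi * (k + s) - g t)%:E); last first.
  by apply/funext => t; congr (_%:E); rewrite /g /log_kernel -/c; ring.
rewrite (_ : (fun t => (2 * pi * (ln (cmod s0) + k - _))%:E) =
    fun t => (2 * pi * (k + s) - f t)%:E); last first.
  apply/funext => t; congr (_%:E); rewrite /f /log_kernel -/c cmodM cc.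
  have -> : Num.max (cmod (S F).[u t]) (cmod s0 * c) =
      cmod s0 * Num.max (cmod (S F).[u t] / cmod s0) c.
    by rewrite maxr_pMr // [_ * (_ / _)]mulrC divfK ?gt_eqF.
  by rewrite lnM ?posrE // ?lt_max ?c0 ?orbT //; ring.
have mf : measurable_fun setT f.
  apply: measurable_funM; first exact: measurable_cst.
  apply: measurable_log_kernel; last exact: measurable_cst.
  apply: measurable_funM; last exact: measurable_cst.
  exact: measurable_cmod_horner.
have mg : measurable_fun setT g.
  apply: measurable_funM; first exact: measurable_cst.
  apply: measurable_log_kernel; last exact: measurable_cst.
  exact: measurable_cmod_horner.
have f0 t : 0 <= f t by rewrite mulr_ge0 ?log_kernel_ge0 // ltW.
have g0 t : 0 <= g t by rewrite mulr_ge0 ?log_kernel_ge0 // ltW.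
(* k + s also bounds both log kernels, so that their complements are nonnegative *)
have maxk x : x <= B1 + B2 / cmod s0 -> log_kernel x s <= k + s.
  move=> xB; rewrite lerD2r /k ler_ln ?posrE ?lt_max -/c ?c0 ?orbT //.
  rewrite ge_max (le_trans xB) ?lerDl ?(ltW c0) //= lerDr addr_ge0 //.
  by rewrite divr_ge0.
have fk t : f t <= 2 * pi * (k + s).
  rewrite ler_pM2l // maxk // ler_wpDl // ler_pM2r ?invr_gt0 //.
  exact: SB.
have gk t : g t <= 2 * pi * (k + s).
  by rewrite ler_pM2l // maxk // ler_wpDr ?divr_ge0 // FB.
have := circle_integral_compl mf f0 fk; have := circle_integral_compl mg g0 gk.
set Jf := circle_integral (fun t => (_ - f t)%:E).
set Jg := circle_integral (fun t => (_ - g t)%:E).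
set If := circle_integral (fun t => (f t)%:E); set Ig := circle_integral (fun t => (g t)%:E).
have If0 : (0 <= If)%E by apply: integral_ge0 => t _; rewrite lee_fin.
have Ig0 : (0 <= Ig)%E by apply: integral_ge0 => t _; rewrite lee_fin.
have Jf0 : (0 <= Jf)%E by apply: integral_ge0 => t _; rewrite lee_fin subr_ge0.
have Jg0 : (0 <= Jg)%E by apply: integral_ge0 => t _; rewrite lee_fin subr_ge0.
move=> eg ef le.
have : (If <= Ig)%E.
  move: If Ig Jf Jg If0 Ig0 Jf0 Jg0 eg ef le => [x||] [y||] [z||] [w||] //= _ _ _ _.
  by rewrite -!EFinD => -[e1] -[e2]; rewrite !lee_fin; lra.
rewrite /If /Ig /circle_integral /f /g.
under eq_integral do rewrite EFinM.
under [leRHS]eq_integral do rewrite EFinM.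
rewrite !ge0_integralZl //.
- by rewrite lee_pmul2l // lte_fin.
all: try by rewrite lee_fin ltW.
all: try by move=> t _; rewrite lee_fin log_kernel_ge0.
all: apply/measurable_funTS/measurable_EFinP.
all: apply: measurable_log_kernel; last exact: measurable_cst.
all: try exact: measurable_cmod_horner.
by apply: measurable_funM; [exact: measurable_cmod_horner|exact: measurable_cst].
Qed.

(** Integrate [log_kernel_preserver] against exp (- p s) ds. *)
Lemma arestov (p : K) : 0 < p ->
  (circle_integral (fun t => (cmod (S F).[u t] `^ p)%:E) <=
   (cmod s0 `^ p)%:E * circle_integral (fun t => (cmod F.[u t] `^ p)%:E))%E.
Proof.
move=> p0; have s0n := preserver_neq0 pS.
have s0p : 0 < cmod s0 by rewrite cmod_gt0.
pose w (s : K) := expR (- (p * s)).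
have w0 s : 0 <= w s by exact: expR_ge0.
have layer (f : K -> K) : measurable_fun setT f -> (forall t, 0 <= f t) ->
  [/\ ((p ^- 2)%:E * circle_integral (fun t => (f t `^ p)%:E) =
    \int[mu]_(s in [set: K]) ((w s)%:E * circle_integral (fun t => (log_kernel (f t) s)%:E)))%E,
   measurable_fun [set: measurableTypeR K]
     (fun s : measurableTypeR K => (w s)%:E * circle_integral (fun t => (log_kernel (f t) s)%:E))%E
   & forall s, (0 <= (w s)%:E * circle_integral (fun t => (log_kernel (f t) s)%:E))%E].
  move=> mf f0.
  have k0 t s : (0 <= (w s * log_kernel (f t) s)%:E)%E.
    by rewrite lee_fin mulr_ge0 ?log_kernel_ge0.
  have mk : measurable_fun [set: KK] (fun z : KK => (w z.2 * log_kernel (f z.1) z.2)%:E).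
    apply/measurable_EFinP; apply: measurable_funM.
      apply: (measurableT_comp (@measurable_expR K)); apply: measurable_funN.
      by apply: measurable_funM; [exact: measurable_cst|exact: measurable_snd].
    apply: measurable_log_kernel; last exact: measurable_snd.
    by apply: (measurableT_comp mf); exact: measurable_fst.
  have pull s : ((w s)%:E * circle_integral (fun t => (log_kernel (f t) s)%:E) =
      \int[mu]_(t in `[0%R, (2 * pi)%R]) (w s * log_kernel (f t) s)%:E)%E.
    under [RHS]eq_integral do rewrite EFinM.
    rewrite ge0_integralZl //.
    - apply/measurable_funTS/measurable_EFinP.
      by apply: measurable_log_kernel => //; exact: measurable_cst.
    - by move=> t _; rewrite lee_fin log_kernel_ge0.
    - by rewrite lee_fin.
  split.
  - under [RHS]eq_integral do rewrite pull.
    rewrite -(@tonelli_in K `[0, 2 * pi] setT (fun t s => (w s * log_kernel (f t) s)%:E)) //.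
    rewrite /circle_integral -ge0_integralZl //.
    + by apply: eq_integral => t _; rewrite -EFinM; apply/esym/integral_log_kernel.
    + apply/measurable_funTS/measurable_EFinP.
      exact: (measurableT_comp (measurable_powR _)).
    + by move=> t _; rewrite lee_fin powR_ge0.
    + by rewrite lee_fin invr_ge0 exprn_ge0 // ltW.
  - have := @measurable_integral_in K `[0, 2 * pi] (fun t s => (w s * log_kernel (f t) s)%:E)
      (measurable_itv _) mk k0.
    by congr (measurable_fun _ _); apply/funext => s; rewrite pull.
  - by move=> s; rewrite pull; apply: integral_ge0.
have mf P : measurable_fun setT (fun t => cmod P.[u t]).
  exact: measurable_cmod_horner.
have [fE fm f0] := layer _ (measurable_funM (mf (S F)) (@measurable_cst _ _ _ _ _ (cmod s0)^-1))
  (fun t => divr_ge0 (cmod_ge0 _) (cmod_ge0 _)).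
have [gE gm g0] := layer _ (mf F) (fun t => cmod_ge0 _).
have ip : (0 < (p ^- 2)%:E :> \bar K)%E by rewrite lte_fin invr_gt0 exprn_gt0.
have : ((p ^- 2)%:E * circle_integral (fun t => ((cmod (S F).[u t] / cmod s0) `^ p)%:E) <=
        (p ^- 2)%:E * circle_integral (fun t => (cmod F.[u t] `^ p)%:E))%E.
  rewrite fE gE; apply: ge0_le_integral => // s _.
  by rewrite lee_wpmul2l // ?lee_fin // log_kernel_preserver.
rewrite lee_pmul2l // => le.
rewrite (_ : (fun t => (cmod (S F).[u t] `^ p)%:E) =
  fun t => ((cmod s0 `^ p)%:E * ((cmod (S F).[u t] / cmod s0) `^ p)%:E)%E); last first.
  apply/funext => t; rewrite -EFinM -powRM ?divr_ge0 //.
  by rewrite [cmod s0 * _]mulrC divfK ?gt_eqF.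
rewrite /circle_integral ge0_integralZl //.
- by rewrite lee_wpmul2l // lee_fin powR_ge0.
- apply/measurable_funTS/measurable_EFinP.
  apply: (measurableT_comp (measurable_powR _)).
  by apply: measurable_funM; [exact: mf|exact: measurable_cst].
- by move=> t _; rewrite lee_fin powR_ge0.
- by rewrite lee_fin powR_ge0.
Qed.

End Preserver.

End Arestov.

(** * Multipliers and conjugate reversal *)

Section Multiplier.
Context {K : realType}.
Local Notation C := K[i].
Local Notation u := (@unit_circle K).
Implicit Types (F G H P Q : {poly C}) (t : nat -> C).

Definition multiplier n t P : {poly C} := \poly_(k < n.+1) (t k * P`_k).

(** The polynomial z^n conj (P (1 / conj z)), which depends on the formal degree n. *)
Definition conj_reverse n P : {poly C} := \poly_(k < n.+1) (P`_(n - k))^*%C.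

Lemma coef_multiplier n t P k : (size P <= n.+1)%N ->
  (multiplier n t P)`_k = t k * P`_k.
Proof.
move=> sP; rewrite coef_poly; case: ltnP => // nk.
by rewrite nth_default ?mulr0 // (leq_trans sP).
Qed.

Lemma size_multiplier n t P : (size (multiplier n t P) <= n.+1)%N.
Proof. exact: size_poly. Qed.

Lemma multiplierD n t P Q (eta : C) :
  multiplier n t (P + eta *: Q) = multiplier n t P + eta *: multiplier n t Q.
Proof.
apply/polyP => k; rewrite coefD coefZ !coef_poly; case: ltnP => _; last by rewrite mulr0 addr0.
by rewrite coefD coefZ; ring.
Qed.

Lemma multiplier1 n t : multiplier n t 1 = (t 0%N)%:P.
Proof.
apply/polyP => k; rewrite coef_poly coef1 coefC; case: k => [|k] /=; first by rewrite mulr1.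
by rewrite mulr0; case: ifP.
Qed.

Lemma multiplier_horner0 n t P : (multiplier n t P).[0] = t 0%N * P.[0].
Proof. by rewrite !horner_coef0 coef_poly. Qed.

Lemma size_conj_reverse n P : (size (conj_reverse n P) <= n.+1)%N.
Proof. exact: size_poly. Qed.

Lemma coef_conj_reverse n P k : (k <= n)%N -> (conj_reverse n P)`_k = (P`_(n - k))^*%C.
Proof. by move=> kn; rewrite coef_poly ltnS kn. Qed.

Lemma conj_reverseK n P : (size P <= n.+1)%N -> conj_reverse n (conj_reverse n P) = P.
Proof.
move=> sP; apply/polyP => k; have [kn|nk] := leqP k n.
  by rewrite !coef_conj_reverse ?leq_subr // conjcK subKn.
by rewrite coef_poly ltnNge nk /= nth_default // (leq_trans sP).
Qed.

Lemma horner_conj_reverse n P (z : C) : (size P <= n.+1)%N -> z != 0 ->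
  (conj_reverse n P).[z] = z ^+ n * (P.[(z^*%C)^-1])^*%C.
Proof.
move=> sP z0; rewrite horner_poly (horner_coef_wide _ sP) rmorph_sum mulr_sumr.
rewrite (reindex_inj rev_ord_inj) /=; apply: eq_bigr => k _.
have kn : (k <= n)%N by rewrite -ltnS.
rewrite subSS subKn // rmorphM rmorphXn /= -conjc_inv conjcK.
rewrite mulrCA; congr (_ * _).
have -> : z ^+ n = z ^+ (n - k) * z ^+ k by rewrite -exprD subnK.
by rewrite exprVn mulfK // expf_neq0.
Qed.

Lemma conj_reverse_multiplier n t P : (size P <= n.+1)%N ->
  conj_reverse n (multiplier n t (conj_reverse n P)) =
  multiplier n (fun k => (t (n - k)%N)^*%C) P.
Proof.
move=> sP; apply/polyP => k; have [kn|nk] := leqP k n; last first.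
  by rewrite !coef_poly ltnNge nk.
rewrite coef_conj_reverse // coef_multiplier ?size_conj_reverse // coef_multiplier //.
by rewrite coef_conj_reverse ?leq_subr // subKn // rmorphM /= conjcK.
Qed.

Lemma cmod_conj_reverse_circle n P s : (size P <= n.+1)%N ->
  cmod (conj_reverse n P).[u s] = cmod P.[u s].
Proof.
move=> sP; rewrite horner_conj_reverse ?circle_neq0 //.
rewrite cmodM cmodX cmod_circle expr1n mul1r cmod_conj.
have -> // : ((u s)^*%C)^-1 = u s.
have c0 : (u s)^*%C != 0 by rewrite conjc_eq0 circle_neq0.
by apply: (mulIf c0); rewrite mulVf // circle_conj.
Qed.

(** The reversals of the zero-free polynomials. The degree is exactly n since a zero
    at infinity is excluded as well. *)
Definition zeros_in_disc n P := size P = n.+1 /\ forall z, 1 < cmod z -> P.[z] != 0.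

Lemma zeros_in_disc_reverse n P : (size P <= n.+1)%N -> zero_free_disc P ->
  zeros_in_disc n (conj_reverse n P).
Proof.
move=> sP /zero_free_discP Pz; split=> [|z z1].
  apply/eqP; rewrite eqn_leq size_conj_reverse ltnNge; apply/negP => sR.
  have := Pz 0; rewrite cmod0 ltr01 horner_coef0 => /(_ isT) /negP; apply.
  rewrite -conjc_eq0 -(subnn n) -coef_conj_reverse //.
  by apply/eqP; exact: nth_default.
have z0 : z != 0 by rewrite -cmod_gt0 (lt_trans _ z1).
rewrite horner_conj_reverse // mulf_neq0 ?expf_neq0 // conjc_eq0 Pz //.
by rewrite cmodV cmod_conj invf_lt1 // (lt_trans _ z1).
Qed.

Lemma zero_free_disc_reverse n P : (size P <= n.+1)%N -> P`_n != 0 ->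
  (forall z, 1 < cmod z -> P.[z] != 0) -> zero_free_disc (conj_reverse n P).
Proof.
move=> sP Pn0 Pz; apply/zero_free_discP => z z1.
have [->|z0] := eqVneq z 0.
  by rewrite horner_coef0 coef_conj_reverse // subn0 conjc_eq0.
rewrite horner_conj_reverse // mulf_neq0 ?expf_neq0 // conjc_eq0 Pz //.
by rewrite cmodV cmod_conj invf_gt1 // cmod_gt0.
Qed.

Section Star.
Context (n : nat) (t : nat -> C).
Context (tz : forall P, zeros_in_disc n P -> forall z, 1 < cmod z -> (multiplier n t P).[z] != 0).
Context (tn : t n != 0).
Let ts k := (t (n - k)%N)^*%C.
Local Notation T := (multiplier n t).
Local Notation T' := (multiplier n ts).

(** The reversal exchanges the zero-free polynomials with those of
    [zeros_in_disc], whose images by T do not vanish outside the disc. *)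
Lemma star_preserver : zero_free_preserver n (t n)^*%C T'.
Proof.
split=> [F G eta||F|F sF Fz].
- exact: multiplierD.
- by rewrite multiplier1 /ts subn0.
- by rewrite multiplier_horner0 /ts subn0.
rewrite -conj_reverse_multiplier //; have [sR Rz] := zeros_in_disc_reverse sF Fz.
apply: zero_free_disc_reverse; rewrite ?size_multiplier //; last exact: tz.
rewrite coef_multiplier ?size_conj_reverse // mulf_neq0 //.
have := lead_coef_eq0 (conj_reverse n F); rewrite lead_coefE sR /= => ->.
by rewrite -size_poly_eq0 sR.
Qed.

(** The reversal Q of P has |Q| = |P| on the circle, so T' P dominates T' Q there;
    and T' Q is the reversal of T P. *)
Lemma le_star P : (size P <= n.+1)%N -> zero_free_disc P ->
  forall s, cmod (T P).[u s] <= cmod (T' P).[u s].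
Proof.
move=> sP Pz s.
have -> : cmod (T P).[u s] = cmod (T' (conj_reverse n P)).[u s].
  rewrite -(@cmod_conj_reverse_circle n (T P)) ?size_multiplier //.
  by rewrite -conj_reverse_multiplier ?size_conj_reverse // conj_reverseK.
apply: le_cmod_circle; apply: (preserver_dominates star_preserver) => //.
  exact: size_conj_reverse.
by move=> s'; rewrite cmod_conj_reverse_circle.
Qed.

Lemma star_pencil_preserver (eta : C) : cmod eta < 1 ->
  zero_free_preserver n ((t n)^*%C + eta * t 0%N) (fun P => T' P + eta *: T P).
Proof.
move=> eta1; split=> [F G e||F|F sF Fz].
- rewrite !multiplierD !scalerDr !scalerA [eta * e]mulrC -!addrA; congr (_ + _).
  by rewrite addrCA.
- by rewrite !multiplier1 /ts subn0 -mul_polyC -polyCM -polyCD.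
- by rewrite hornerD hornerZ !multiplier_horner0 /ts subn0; ring.
apply: zero_free_discD => //; last exact: le_star.
by case: star_preserver => _ _ _; apply.
Qed.

End Star.

(** Gives monotonicity of power means in the radius, and at radius zero the bound
    |F(0)|^p <= mean of |F|^p. *)
Lemma dilation_preserver n (rho : K) : 0 <= rho <= 1 ->
  zero_free_preserver n 1 (dilate rho).
Proof.
move=> /andP[r0 r1]; rewrite /dilate; split=> [F G eta||F|F sF /zero_free_discP Fz].
- by rewrite comp_polyD comp_polyZ.
- by rewrite comp_polyC.
- by rewrite horner_comp hornerZ hornerX mulr0 mul1r.
apply/zero_free_discP => z z1; rewrite horner_comp Fz // hornerZ hornerX cmodM.
by rewrite cmod_real ger0_norm // (le_lt_trans _ z1) // ler_piMl.
Qed.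

End Multiplier.

(** * Symmetric functions of points of a half plane *)

Section HalfPlane.
Context {K : realType}.
Local Notation C := K[i].
Local Notation Re := complex.Re.
Local Notation Im := complex.Im.
Implicit Types (z w x y : C) (s : seq C) (p : {poly C}).

(** The second elementary symmetric function. *)
Fixpoint esym2 s : C := if s is x :: s' then x * \sum_(y <- s') y + esym2 s' else 0.

Lemma ReD z w : Re (z + w) = Re z + Re w. Proof. by case: z; case: w. Qed.
Lemma ReN z : Re (- z) = - Re z. Proof. by case: z. Qed.
Lemma Re_realM (a : K) z : Re (a%:C * z) = a * Re z.
Proof. by case: z => b c /=; rewrite mul0r subr0. Qed.

Lemma Re_inv_gt0 z : 0 < Re z -> 0 < Re z^-1.
Proof.
case: z => a b /= a0; rewrite divr_gt0 //.
by rewrite ltr_wpDr ?sqr_ge0 // exprn_gt0.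
Qed.

Lemma Re_sum_gt0 s : s != [::] -> (forall y, y \in s -> 0 < Re y) ->
  0 < Re (\sum_(y <- s) y).
Proof.
case: s => // x s _; elim: s x => [|y s IH] x sP.
  by rewrite big_seq1 sP // mem_head.
rewrite big_cons ReD addr_gt0 //; first exact/sP/mem_head.
apply: IH => z zs; by apply: sP; rewrite in_cons zs orbT.
Qed.

(** Logarithmic derivatives: Q'/Q and Q''/(2Q) are the elementary symmetric
    functions of the 1/(z - w). *)
Lemma horner_deriv_prod s z : (forall w, w \in s -> z != w) ->
  let Q := \prod_(w <- s) ('X - w%:P) in
  let l := [seq (z - w)^-1 | w <- s] in
  Q^`().[z] = Q.[z] * (\sum_(y <- l) y) /\
  Q^`(2).[z] = 2 * (Q.[z] * esym2 l).
Proof.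
elim: s => [|w s IH] zs /=.
  by rewrite !big_nil -polyC1 !derivC !horner0 !mulr0.
have /IH[e1 e2] : forall w', w' \in s -> z != w'.
  by move=> w' w's; apply: zs; rewrite in_cons w's orbT.
have zw : z - w != 0 by rewrite subr_eq0 zs // mem_head.
rewrite !big_cons; set Q := \prod_(_ <- s) _ in e1 e2 *.
set l := [seq _ | _ <- s] in e1 e2 *.
have d1 : (('X - w%:P) * Q)^`() = Q + ('X - w%:P) * Q^`().
  by rewrite derivM derivXsubC mul1r.
have d2 : (('X - w%:P) * Q)^`()^`() = Q^`() + Q^`() + ('X - w%:P) * Q^`()^`().
  by rewrite d1 derivD derivM derivXsubC mul1r addrA.
split.
  by rewrite d1 hornerD !hornerM hornerXsubC e1; field.
by rewrite d2 !hornerD !hornerM hornerXsubC e1 e2; field.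
Qed.

Lemma esym2_scale (c : C) s : esym2 [seq c * y | y <- s] = c ^+ 2 * esym2 s.
Proof.
elim: s => [|y s IH] /=; first by rewrite mulr0.
by rewrite IH big_map -mulr_sumr; ring.
Qed.

(** Gauss-Lucas for a half plane: p'/p is a sum of numbers 1/(z - w) of positive real
    part. *)
Lemma deriv_neq0_halfplane (c : K) p : (1 < size p)%N ->
  (forall z, c <= Re z -> p.[z] != 0) -> forall z, c <= Re z -> p^`().[z] != 0.
Proof.
move=> sp pz z cz; have [r pE] := closed_field_poly_normal p.
have a0 : lead_coef p != 0.
  by rewrite lead_coef_eq0 -size_poly_gt0 (ltn_trans _ sp).
have rc w : w \in r -> Re w < c.
  move=> wr; rewrite ltNge; apply/negP => /pz; rewrite pE hornerZ mulf_eq0 (negbTE a0) /=.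
  by rewrite -rootE root_prod_XsubC wr.
have zr w : w \in r -> z != w.
  by move=> /rc wc; apply: contraTneq wc => <-; rewrite -leNgt.
have [d1 _] := horner_deriv_prod zr.
have := pz z cz; rewrite {1}pE hornerZ mulf_eq0 negb_or => /andP[_ Qz].
rewrite pE derivZ hornerZ d1 !mulf_neq0 //.
have : 0 < Re (\sum_(y <- [seq (z - w)^-1 | w <- r]) y).
  apply: Re_sum_gt0.
    move: sp; rewrite pE size_scale // size_prod_XsubC.
    by case: (r).
  move=> y /mapP[w /rc wc ->]; apply: Re_inv_gt0.
  by rewrite ReD ReN subr_gt0 (lt_le_trans wc).
by apply: contraTneq => ->; rewrite ltxx.
Qed.

Lemma size_deriv_char0 p : size p^`() = (size p).-1.
Proof.
have [p0|p0] := leqP (size p) 1.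
  by move: p0 => /size1_polyC ->; rewrite derivC size_poly0 size_polyC; case: eqP.
have sp0 : (0 < size p)%N by exact: ltnW.
have pn0 : p != 0 by rewrite -size_poly_gt0.
apply/eqP; rewrite eqn_leq; apply/andP; split.
  by rewrite -ltnS prednK // lt_size_deriv.
rewrite leqNgt; apply/negP => sd.
have sp1 : (size p).-2.+1 = (size p).-1 by case: (size p) p0 => [|[]].
have : p^`()`_(size p).-2 = 0 by apply: nth_default; rewrite -ltnS sp1.
rewrite coef_deriv => /eqP; rewrite -mulr_natr mulf_eq0 pnatr_eq0 orbF sp1.
by rewrite -lead_coefE lead_coef_eq0 (negbTE pn0).
Qed.

Lemma derivn_neq0_halfplane (c : K) p k : (k < size p)%N ->
  (forall z, c <= Re z -> p.[z] != 0) ->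
  size p^`(k) = (size p - k)%N /\ forall z, c <= Re z -> p^`(k).[z] != 0.
Proof.
move=> + pz; elim: k => [|k IH] kp; first by rewrite subn0.
have [sk kz] := IH (ltnW kp).
rewrite derivnS size_deriv_char0 sk subnS; split=> //.
by apply: deriv_neq0_halfplane => //; rewrite sk ltn_subRL addn1.
Qed.

Lemma coef_prod_Xadd s : let q := \prod_(y <- s) ('X + y%:P) in
  [/\ q`_(size s) = 1,
      forall k, size s = k.+1 -> q`_k = \sum_(y <- s) y
    & forall k, size s = k.+2 -> q`_k = esym2 s].
Proof.
elim: s => [|y s [q0 q1 q2]] /=; first by rewrite !big_nil coefC.
rewrite !big_cons; set q := \prod_(_ <- s) _ in q0 q1 q2 *.
have cE k : (('X + y%:P) * q)`_k.+1 = q`_k + y * q`_k.+1.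
  by rewrite mulrDl coefD coefXM coefCM.
have c0 : (('X + y%:P) * q)`_0 = y * q`_0.
  by rewrite mulrDl coefD coefXM coefCM /= add0r.
have qbig : q`_(size s).+1 = 0.
  apply: nth_default; rewrite /q.
  have -> : \prod_(z <- s) ('X + z%:P) = \prod_(z <- [seq - z | z <- s]) ('X - z%:P).
    by rewrite big_map; apply: eq_bigr => z _; rewrite rmorphN opprK.
  by rewrite size_prod_XsubC size_map.
split=> [|k [sk]|k [sk]].
- by rewrite cE q0 qbig mulr0 addr0.
- case: k sk => [|k] sk.
    by rewrite c0 -{1}sk q0 (size0nil sk) big_nil mulr1 addr0.
  by rewrite cE -sk q0 mulr1 (q1 _ sk) addrC.
- case: k sk => [|k] sk.
    rewrite c0 (q1 _ sk); case: s {q q0 q1 q2 cE c0 qbig} sk => // a [|] //= _.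
    by rewrite big_nil mulr0 !addr0.
  by rewrite cE (q1 _ sk) (q2 _ sk) addrC.
Qed.

(** The sum and esym2 are, up to constants, coefficients of the derivative of order
    n of the product of the X + y, a quadratic polynomial whose two zeros are the - x
    and - y sought, located by Gauss-Lucas. *)
Lemma esym12_halfplane (c : K) s (n : nat) : size s = n.+2 ->
  (forall y, y \in s -> c < Re y) ->
  exists x y, [/\ c < Re x, c < Re y,
    \sum_(z <- s) z = n.+2%:R / 2 * (x + y)
    & esym2 s = n.+2%:R * n.+1%:R / 2 * (x * y)].
Proof.
move=> ss sc; set q := \prod_(y <- s) ('X + y%:P).
have qE : q = \prod_(z <- [seq - z | z <- s]) ('X - z%:P).
  by rewrite big_map; apply: eq_bigr => z _; rewrite rmorphN opprK.
have sq : size q = n.+3 by rewrite qE size_prod_XsubC size_map ss.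
have qz z : - c <= Re z -> q.[z] != 0.
  move=> cz; rewrite -rootE qE root_prod_XsubC; apply/negP => /mapP[w ws zw].
  by have := sc w ws; move: cz; rewrite zw ReN lerN2 => /le_lt_trans h /h; rewrite ltxx.
have nq : (n < size q)%N by rewrite sq; lia.
have [s2 dz] := derivn_neq0_halfplane nq qz.
have {s2}s3 : size q^`(n) = 3%N by rewrite s2 sq; lia.
have [r pE] := closed_field_poly_normal q^`(n).
have a0 : lead_coef q^`(n) != 0 by rewrite lead_coef_eq0 -size_poly_gt0 s3.
have : size r = 2%N.
  by apply/eqP; rewrite -eqSS -(size_prod_XsubC r id) -(size_scale _ a0) -pE s3.
case: r pE => [|r1 [|r2 [|]]] // pE _.
have [q0 q1 q2] := coef_prod_Xadd s; rewrite -/q in q0 q1 q2.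
have rc w : w \in [:: r1; r2] -> c < Re (- w).
  move=> wr; rewrite ReN ltrNr ltNge; apply/negP => /dz.
  by rewrite pE hornerZ mulf_eq0 (negbTE a0) /= -rootE root_prod_XsubC wr.
exists (- r1), (- r2); rewrite !rc ?in_cons ?eqxx ?orbT //.
set a := lead_coef _ in pE a0.
have cE i : q`_(n + i) * ((n + i) ^_ n)%:R = (a *: \prod_(z <- [:: r1; r2]) ('X - z%:P))`_i.
  by rewrite mulr_natr -pE coef_derivn.
have XE : \prod_(z <- [:: r1; r2]) ('X - z%:P) = 'X^2 + (- (r1 + r2)) *: 'X + (r1 * r2)%:P.
  by rewrite !big_cons big_nil mulr1 -mul_polyC rmorphN rmorphD rmorphM /=; ring.
have := cE 0%N; have := cE 1%N; have := cE 2%N.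
rewrite XE !coefZ !coefD !coefZ !coefXn !coefX !coefC /= !mulr1 !mulr0 !addr0 !add0r.
rewrite addn0 addn1 addn2 -{1}ss q0 (q1 _ ss) (q2 _ ss) ffactnn.
have f1 : (n.+1 ^_ n = n.+1 * n`!)%N.
  by have := ffact_fact (leqnSn n); rewrite subSnn (_ : 1`! = 1)%N // muln1 factS.
(* the falling factorials come from the derivative of order n *)
have f2 : (n.+2 ^_ n * 2 = n.+2 * (n.+1 * n`!))%N.
  have := ffact_fact (leqW (leqnSn n)).
  by rewrite subSn ?leqnSn // subSnn (_ : 2`! = 2)%N // !factS.
have {f2}f2 : (n.+2 ^_ n)%:R * 2 = n.+2%:R * (n.+1%:R * (n`!)%:R) :> C.
  by rewrite -!natrM f2.
rewrite f1 mul1r natrM => aE e1 e2.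
have F0 : (n`!)%:R != 0 :> C by rewrite pnatr_eq0 -lt0n fact_gt0.
have n1 : n.+1%:R != 0 :> C by rewrite pnatr_eq0.
have n2 : n.+2%:R != 0 :> C by rewrite pnatr_eq0.
have aE2 : a = n.+2%:R * n.+1%:R * (n`!)%:R / 2.
  have t0 : 2 != 0 :> C by rewrite pnatr_eq0.
  by apply: (mulIf t0); rewrite -[a]mulr1 -aE f2 divfK // mulrA.
split=> //.
- apply: (mulIf (mulf_neq0 n1 F0)); rewrite e1 aE2; ring.
- apply: (mulIf F0); rewrite e2 aE2; ring.
Qed.

(** With d1 = p - q, d2 = r - s and sigma = p + q, vanishing means
    d1^2 + d2^2 = 2 sigma^2, where |Re d1| and |Re d2| are less than Re sigma. The
    real part bounds the imaginary parts of d1 and d2 by that of sigma, and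
    Cauchy-Schwarz then contradicts the imaginary part. *)
Lemma harmonic_halfplane (p q r s : C) :
  0 < Re p -> 0 < Re q -> 0 < Re r -> 0 < Re s ->
  p + q = r + s -> p * q + r * s != 0.
Proof.
case: p => a b; case: q => c d; case: r => e f; case: s => g h /=.
move=> a0 c0 e0 g0 [ac bd]; apply/negP => /eqP [re im].
pose A := a - c; pose B := e - g; pose S := a + c; pose T := b + d.
pose X := b - d; pose Y := f - h.
have AS : A ^+ 2 + B ^+ 2 < 2 * S ^+ 2.
  have BS : S = e + g by [].
  have : 0 < a * c by rewrite mulr_gt0.
  have : 0 < e * g by rewrite mulr_gt0.
  have -> : 2 * S ^+ 2 = (a + c) ^+ 2 + (e + g) ^+ 2 by rewrite -ac /S; ring.
  rewrite /A /B; nra.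
have e1 : A ^+ 2 + B ^+ 2 - X ^+ 2 - Y ^+ 2 = 2 * (S ^+ 2 - T ^+ 2).
  have -> : 2 * (S ^+ 2 - T ^+ 2) = (a + c) ^+ 2 + (e + g) ^+ 2 - (b + d) ^+ 2 - (f + h) ^+ 2.
    by rewrite -ac -bd /S /T; ring.
  rewrite /A /B /X /Y; nra.
have e2 : A * X + B * Y = 2 * (S * T).
  have -> : 2 * (S * T) = (a + c) * (b + d) + (e + g) * (f + h).
    by rewrite -ac -bd /S /T; ring.
  rewrite /A /B /X /Y; nra.
have XY : X ^+ 2 + Y ^+ 2 < 2 * T ^+ 2 by lra.
have cs : (A * X + B * Y) ^+ 2 <= (A ^+ 2 + B ^+ 2) * (X ^+ 2 + Y ^+ 2).
  rewrite -subr_ge0 (_ : _ - _ = (A * Y - B * X) ^+ 2) ?sqr_ge0 //; ring.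
have : (A ^+ 2 + B ^+ 2) * (X ^+ 2 + Y ^+ 2) < (2 * S ^+ 2) * (2 * T ^+ 2).
  by apply: ltr_pM => //; rewrite addr_ge0 ?sqr_ge0.
by rewrite e2 in cs; rewrite ltNge => /negP; apply; apply: le_trans cs; rewrite le_eqVlt; apply/orP; left; apply/eqP; ring.
Qed.

(** Walsh's coincidence theorem in degree two: for the zeros a and b of the quadratic
    polynomial, the polar form is a multiple of (x - a)(y - b) + (x - b)(y - a). *)
Lemma quadratic_polar_neq0 (h : K) (c0 c1 c2 x y : C) :
  (forall z, h < Re z -> c0 + c1 * z + c2 * z ^+ 2 != 0) ->
  h < Re x -> h < Re y -> c0 + c1 * ((x + y) / 2) + c2 * (x * y) != 0.
Proof.
move=> uz hx hy; have [c20|c20] := eqVneq c2 0.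
  have hm : h < Re ((x + y) / 2).
    have -> : (x + y) / 2 = (2^-1)%:C * (x + y) by rewrite mulrC fmorphV rmorph_nat.
    by rewrite Re_realM ReD; lra.
  by have := uz _ hm; rewrite c20 !mul0r !addr0.
(* roots a and b of c0 + c1 z + c2 z^2 *)
pose d := sqrtc (c1 ^+ 2 - 4 * c0 * c2).
have d2 : d ^+ 2 = c1 ^+ 2 - 4 * c0 * c2 by rewrite sqr_sqrtc.
pose a := (- c1 + d) / (2 * c2); pose b := (- c1 - d) / (2 * c2).
have two0 : 2 != 0 :> C by rewrite pnatr_eq0.
have c1E : c1 = - c2 * (a + b) by rewrite /a /b; field; rewrite c20.
have c0E : c0 = c2 * (a * b).
  have -> : c2 * (a * b) = (c1 ^+ 2 - d ^+ 2) / (4 * c2) by rewrite /a /b; field; rewrite c20.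
  by rewrite d2; field; rewrite c20.
have ha : Re a <= h.
  rewrite leNgt; apply/negP => /uz; rewrite c0E c1E => /negP; apply; apply/eqP; ring.
have hb : Re b <= h.
  rewrite leNgt; apply/negP => /uz; rewrite c0E c1E => /negP; apply; apply/eqP; ring.
have -> : c0 + c1 * ((x + y) / 2) + c2 * (x * y) =
    c2 / 2 * ((x - a) * (y - b) + (x - b) * (y - a)).
  by rewrite c0E c1E; field.
rewrite !mulf_neq0 ?invr_eq0 //; apply: harmonic_halfplane; last by ring.
all: by rewrite ReD ReN; lra.
Qed.

End HalfPlane.

(** * Zeros and the operators of the theorem *)

Section Operator.
Context {K : realType}.
Local Notation C := K[i].
Local Notation Re := complex.Re.
Local Notation Im := complex.Im.
Implicit Types (z w : C) (P : {poly C}).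

Lemma coef_dilate (R : K) P k : (dilate R P)`_k = (R ^+ k)%:C * P`_k.
Proof.
rewrite /dilate; elim/poly_ind: P k => [|P c IH] k.
  by rewrite comp_poly0 !coef0 mulr0.
rewrite comp_poly_MXaddC coefD coefC -scalerAr coefZ coefMX coefD coefMX coefC.
case: k => [|k] /=; first by rewrite mulr0 !add0r expr0 mul1r.
by rewrite IH !addr0 exprS rmorphM /=; ring.
Qed.

Lemma horner_dilate (R : K) P z : (dilate R P).[z] = P.[R%:C * z].
Proof. by rewrite /dilate horner_comp hornerZ hornerX. Qed.

Section Bn.
Context (n : nat) (l0 l1 l2 : C).

Definition Bop_eigenvalue (k : nat) : C :=
  l0 + l1 * (n%:R / 2 * k%:R) + l2 * ((n%:R / 2) ^+ 2 * (k * k.-1)%:R / 2).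

Lemma coef_Bop P k : (Bop n l0 l1 l2 P)`_k = Bop_eigenvalue k * P`_k.
Proof.
rewrite /Bop !coefD !coefZ !exprZn -!scalerAl -!scalerAr !coefZ coefXM coefXnM.
rewrite coef_deriv /= !coef_deriv /Bop_eigenvalue invr1.
case: k => [|[|k]] /=.
- by rewrite mul0n !mulr0 !mul0r !mulr0 !addr0.
- by rewrite muln0 mulr0n; ring.
rewrite -?mulrnA; have h m : P`_k.+2 *+ m = P`_k.+2 * m%:R by rewrite mulr_natr.
by rewrite !subSS subn0 !h (_ : 2`! = 2)%N // !natrM; field.
Qed.

Lemma Bop_eigenvalue_n : Bop_eigenvalue n = Lambda n l0 l1 l2.
Proof.
rewrite /Bop_eigenvalue /Lambda; case: n => [|m] /=.
  by rewrite mul0n; ring.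
by rewrite natrM -natr1; field.
Qed.

Lemma horner_Bop P z : (Bop n l0 l1 l2 P).[z] =
  l0 * P.[z] + l1 * (n%:R / 2 * (z * P^`().[z]))
  + l2 * ((n%:R / 2) ^+ 2 * (z ^+ 2 * P^`(2).[z] / 2)).
Proof.
rewrite /Bop !hornerD !hornerZ !hornerM ?horner_exp !hornerZ !hornerX invr1.
by rewrite (_ : 2`! = 2)%N //; ring.
Qed.

Context (n0 : (0 < n)%N) (hB : inB n l0 l1 l2).

(** The half plane |z| <= |z - n/2| is Re z <= n/4. *)
Lemma upoly_neq0 z : n%:R / 4 < Re z ->
  l0 + n%:R * l1 * z + 'C(n, 2)%:R * l2 * z ^+ 2 != 0.
Proof.
move=> hz; apply/negP => /eqP uz.
have : root (upoly n l0 l1 l2) z.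
  by rewrite rootE /upoly !hornerD !hornerZ hornerXn hornerX hornerC bin1 uz.
move/hB; rewrite !normr_cmod lecR -(@ler_pXn2r _ 2) ?nnegrE // !sqr_cmod.
have -> : z - n%:R / 2 = z + (- (n%:R / 2))%:C.
  by rewrite rmorphN rmorphM fmorphV /= !rmorph_nat.
have nR : 0 < n%:R :> K by rewrite ltr0n.
case: z hz {uz} => a b /= hz; rewrite addr0.
nra.
Qed.

(** Lambda is the value of u at n/2. *)
Lemma Lambda_neq0 : Lambda n l0 l1 l2 != 0.
Proof.
have nR : 0 < n%:R :> K by rewrite ltr0n.
have hz : n%:R / 4 < Re (n%:R / 2 : C).
  have -> : n%:R / 2 = (n%:R / 2 : K)%:C by rewrite rmorphM fmorphV /= !rmorph_nat.
  by rewrite /=; lra.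
have := upoly_neq0 hz; rewrite /Lambda; congr (_ != 0).
have : 'C(n, 2)%:R * 2 = n%:R * (n%:R - 1) :> C.
  have := bin_ffact n 2; rewrite (_ : 2`! = 2)%N // !ffactnS ffactn0 muln1 => e.
  by rewrite -natrM e natrM; case: (n) n0 => // m _; rewrite -(natr1 m) addrK.
move=> bin; have -> : 'C(n, 2)%:R = n%:R * (n%:R - 1) / 2 :> C.
  by rewrite -bin mulfK // pnatr_eq0.
by field.
Qed.

Lemma Re_div_gt_half z w : cmod w < cmod z -> 2^-1 < Re (z * (z - w)^-1).
Proof.
move=> wz; have zw : z - w != 0.
  by rewrite subr_eq0; apply: contraTneq wz => ->; rewrite ltxx.
have : cmod w ^+ 2 < cmod z ^+ 2 by rewrite ltr_pXn2r ?nnegrE.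
have : 0 < cmod (z - w) ^+ 2 by rewrite exprn_gt0 // cmod_gt0.
rewrite !sqr_cmod; case: z {wz zw} => a b; case: w => c d /= D0 wz.
set D := _ + _ in D0 *.
have -> : a * ((a - c) / D) - b * - ((b - d) / D) = (a * (a - c) + b * (b - d)) / D by ring.
by rewrite ltr_pdivlMr // /D; lra.
Qed.

(** With y_w = z/(z - w), of real part greater than 1/2, B[P](z)/P(z) is an affine
    form in the first two symmetric functions of the y_w. These are the ones of a
    pair repeated, so Walsh's theorem applies to u at n/2 times this pair. *)
Lemma Bop_neq0 P : zeros_in_disc n P ->
  forall z, 1 < cmod z -> (Bop n l0 l1 l2 P).[z] != 0.
Proof.
move=> [sP Pz] z z1; have [r PE] := closed_field_poly_normal P.
have a0 : lead_coef P != 0 by rewrite lead_coef_eq0 -size_poly_gt0 sP.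
have sr : size r = n.
  by apply/eqP; rewrite -eqSS -(size_prod_XsubC r id) -(size_scale _ a0) -PE sP.
move: (lead_coef P) a0 PE => a a0 PE.
have rz w : w \in r -> cmod w < cmod z.
  move=> wr; rewrite (le_lt_trans _ z1) // leNgt; apply/negP => /Pz.
  by rewrite PE hornerZ mulf_eq0 (negbTE a0) /= -rootE root_prod_XsubC wr.
have zr w : w \in r -> z != w.
  by move=> /rz; apply: contraTneq => ->; rewrite ltxx.
have [d1 d2] := horner_deriv_prod zr.
set l := [seq _ | _ <- r] in d1 d2; set Q := \prod_(_ <- r) _ in d1 d2 PE.
have Qz : Q.[z] != 0.
  by have := Pz z z1; rewrite PE hornerZ mulf_eq0 negb_or => /andP[].
pose y := [seq z * x | x <- l].
have yc x : x \in y -> 2^-1 < Re x.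
  by case/mapP => _ /mapP[w wr ->] ->; apply: Re_div_gt_half; exact: rz.
have -> : (Bop n l0 l1 l2 P).[z] = a * Q.[z] *
   (l0 + l1 * (n%:R / 2 * \sum_(x <- y) x) + l2 * ((n%:R / 2) ^+ 2 * esym2 y)).
  rewrite /y esym2_scale big_map -mulr_sumr horner_Bop PE derivZ derivnZ !hornerZ d1 d2.
  by field.
rewrite !mulf_neq0 //.
have sy : size y = n by rewrite !size_map.
have nR : 0 < n%:R :> K by rewrite ltr0n.
have half x : n%:R / 2 * x = (n%:R / 2 : K)%:C * x :> C.
  by rewrite rmorphM fmorphV /= !rmorph_nat.
case: (n) n0 sy nR half upoly_neq0 => // -[|m] _ sy nR half un0.
  (* for n = 1 the polynomial u is affine and one point is left *)
  case: y sy yc => // x [|] // _ yc.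
  have hx : 1%:R / 4 < Re (1%:R / 2 * x).
    by rewrite half Re_realM; have := yc x (mem_head _ _); lra.
  have := un0 _ hx; rewrite bin_small // big_seq1 /= big_nil.
  by congr (_ != 0); ring.
have [x [x' [hx hx' -> ->]]] := esym12_halfplane sy yc.
have h w : 2^-1 < Re w -> m.+2%:R / 4 < Re (m.+2%:R / 2 * w).
  move=> hw; rewrite half Re_realM; nra.
have := quadratic_polar_neq0 un0 (h _ hx) (h _ hx').
congr (_ != 0).
have bin : 'C(m.+2, 2)%:R = m.+2%:R * m.+1%:R / 2 :> C.
  have t0 : 2 != 0 :> C by rewrite pnatr_eq0.
  apply: (mulIf t0); rewrite divfK // -!natrM; congr (_%:R).
  by have := bin_ffact m.+2 2; rewrite (_ : 2`! = 2)%N // !ffactnS ffactn0 muln1.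
by rewrite bin; field.
Qed.

End Bn.

(** The ratio |Rz - w| / |rz - w| is least at w = - z on the circle; both sides are
    compared after squaring. *)
Lemma dilation_factor_lt (R r : K) z w : 1 <= r -> r < R -> cmod w <= 1 -> 1 < cmod z ->
  (R + 1) * cmod (r%:C * z - w) < (r + 1) * cmod (R%:C * z - w).
Proof.
move=> r1 rR w1 z1.
have w2 : cmod w ^+ 2 <= 1 by rewrite exprn_ile1.
have z2 : 1 < cmod z ^+ 2 by rewrite exprn_egt1.
have wz : cmod w ^+ 2 < cmod z ^+ 2 by exact: le_lt_trans z2.
rewrite -(@ltr_pXn2r _ 2) // ?nnegrE ?mulr_ge0 //; try lra.
rewrite !exprMn !sqr_cmod in w2 z2 wz *.
move: w2 z2 wz {w1 z1}; case: z => a b; case: w => c d /= w2 z2 wz.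
rewrite !mul0r !subr0 !addr0 -subr_gt0.
have -> : (r + 1) ^+ 2 * ((R * a - c) ^+ 2 + (R * b - d) ^+ 2)
    - (R + 1) ^+ 2 * ((r * a - c) ^+ 2 + (r * b - d) ^+ 2)
  = (R - r) * ((R + 1) * (r + 1) * (a ^+ 2 + b ^+ 2 - (c ^+ 2 + d ^+ 2))
      + (r * R - 1) * ((a + c) ^+ 2 + (b + d) ^+ 2)) by ring.
rewrite mulr_gt0 ?subr_gt0 // ltr_wpDr //.
  apply: mulr_ge0; last by rewrite addr_ge0 ?sqr_ge0.
  by rewrite subr_ge0 -(mul1r 1) ler_pM //; lra.
by rewrite mulr_gt0 ?subr_gt0 // mulr_gt0 //; lra.
Qed.

(** One factor (R + 1)/(r + 1) for each of the n zeros of P. *)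
Lemma dilation_ratio_lt (R r : K) n P z : 1 <= r -> r < R -> (0 < n)%N ->
  zeros_in_disc n P -> 1 < cmod z ->
  ((R + 1) / (r + 1)) ^+ n * cmod P.[r%:C * z] < cmod P.[R%:C * z].
Proof.
move=> r1 rR n0 [sP Pz] z1; have [s PE] := closed_field_poly_normal P.
have a0 : lead_coef P != 0 by rewrite lead_coef_eq0 -size_poly_gt0 sP.
have sr : size s = n.
  by apply/eqP; rewrite -eqSS -(size_prod_XsubC s id) -(size_scale _ a0) -PE sP.
have sz w : w \in s -> cmod w <= 1.
  move=> ws; rewrite leNgt; apply/negP => /Pz.
  by rewrite PE hornerZ mulf_eq0 (negbTE a0) /= -rootE root_prod_XsubC ws.
rewrite PE !hornerZ !cmodM mulrCA ltr_pM2l ?cmod_gt0 // -sr.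
have rp : 0 < r + 1 by lra.
have Rp : 0 < R + 1 by lra.
have fac w : w \in s -> (R + 1) / (r + 1) * cmod (r%:C * z - w) < cmod (R%:C * z - w).
  move=> /sz w1; rewrite mulrAC ltr_pdivrMr // [ltRHS]mulrC.
  exact: dilation_factor_lt.
move: n0; rewrite -sr; elim: s {PE sr sz} fac => // w s IH fac _.
rewrite !big_cons !hornerM !cmodM !hornerXsubC exprS mulrACA.
have fw := fac w (mem_head _ _).
have [s0|s0] := posnP (size s).
  by rewrite (size0nil s0) /= !big_nil !hornerC cmod1 expr0 !mulr1.
apply: ltr_pM => //.
- by rewrite mulr_ge0 // divr_ge0 // ltW.
- by rewrite mulr_ge0 // exprn_ge0 // divr_ge0 // ltW.
- by apply: IH => // v vs; apply: fac; rewrite in_cons vs orbT.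
Qed.

(** Outside the disc the first term dominates strictly. The leading coefficient
    survives because (R + 1)/(r + 1) < R/r. *)
Lemma dilation_combination_zeros (R r : K) n (f : C) P : 1 <= r -> r < R -> (0 < n)%N ->
  cmod f <= ((R + 1) / (r + 1)) ^+ n ->
  zeros_in_disc n P -> zeros_in_disc n (dilate R P + f *: dilate r P).
Proof.
move=> r1 rR n0 fk Pz; split; last first.
  move=> z z1; have lt := dilation_ratio_lt r1 rR n0 Pz z1.
  rewrite hornerD hornerZ !horner_dilate; apply: contraTneq lt => /eqP.
  rewrite addr_eq0 => /eqP ->; rewrite cmodN cmodM -leNgt.
  by rewrite ler_wpM2r.
have [sP _] := Pz.
have cE k : (dilate R P + f *: dilate r P)`_k = ((R ^+ k)%:C + f * (r ^+ k)%:C) * P`_k.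
  by rewrite coefD coefZ !coef_dilate; ring.
apply/eqP; rewrite eqn_leq; apply/andP; split.
  apply/leq_sizeP => k nk; rewrite cE nth_default ?mulr0 // sP //.
rewrite ltnNge; apply/negP => /leq_sizeP /(_ n (leqnn n)); rewrite cE => /eqP.
rewrite mulf_eq0 => /orP[|]; last first.
  by have := lead_coef_eq0 P; rewrite lead_coefE sP /= -size_poly_eq0 sP => ->.
rewrite addr_eq0 => /eqP /(congr1 (@cmod K)); rewrite cmodN cmodM !cmod_real.
have rp : 0 < r by lra.
have Rp : 0 < R by lra.
rewrite !gtr0_norm ?exprn_gt0 // => RE.
have : R ^+ n <= (((R + 1) / (r + 1)) * r) ^+ n.
  by rewrite RE exprMn ler_wpM2r // ltW // exprn_gt0.
rewrite ler_pXn2r ?nnegrE //; try lra; last first.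
  by rewrite mulr_ge0 ?divr_ge0 //; lra.
rewrite mulrAC ler_pdivlMr; lra.
Qed.

Lemma cmod_phi_le (R r : K) n (alpha beta : C) : 0 < r -> r < R ->
  cmod alpha <= 1 -> cmod beta <= 1 ->
  cmod (phi n R r alpha beta) <= ((R + 1) / (r + 1)) ^+ n.
Proof.
move=> r0 rR a1 b1; rewrite /phi normr_cmod -rmorphB.
set k := (_ / _) ^+ n.
have k1 : 1 <= k.
  by rewrite exprn_ege1 // ler_pdivlMr; lra.
rewrite (le_trans (ler_cmodD _ _)) // cmodN cmodM cmod_real ger0_norm ?subr_ge0 ?(le_trans a1) //.
have : cmod beta * (k - cmod alpha) <= k - cmod alpha.
  by rewrite ler_piMl // subr_ge0 (le_trans a1).
lra.
Qed.

End Operator.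

(** * Power means of pencils of operators *)

Section Means.
Context {K : realType} (p : K) (p0 : 0 < p).
Local Notation C := K[i].
Local Notation mu := (@lebesgue_measure K).
Local Notation u := (@unit_circle K).
Local Notation KK := (measurableTypeR K * measurableTypeR K)%type.
Implicit Types (P Q F : {poly C}) (a b : C).

Definition power_integral P := circle_integral (fun s => (cmod P.[u s] `^ p)%:E).

Definition linear_integral a b := circle_integral (fun s => (cmod (a + b * u s) `^ p)%:E).

Lemma linear_integralE a b : linear_integral a b = power_integral (a%:P + b *: 'X).
Proof.
by congr circle_integral; apply/funext => s; rewrite !hornerE.
Qed.

Lemma power_integral_ge0 P : (0 <= power_integral P)%E.
Proof. by apply: integral_ge0 => s _; rewrite lee_fin powR_ge0. Qed.

Lemma power_integral_fin P : power_integral P \is a fin_num.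
Proof.
have [M M0 PM] := bounded_horner P 1.
rewrite ge0_fin_numE ?power_integral_ge0 //.
apply: (@le_lt_trans _ _ (2 * pi * M `^ p)%:E); last exact: ltry.
rewrite -circle_integral_cst; apply: ge0_le_integral => //.
- by move=> s _; rewrite lee_fin powR_ge0.
- apply/measurable_funTS/measurable_EFinP.
  by apply: (measurableT_comp (measurable_powR _)); exact: measurable_cmod_horner.
- move=> s _; rewrite lee_fin ge0_ler_powR ?nnegrE // ?(ltW p0) //.
  by rewrite PM // cmod_circle.
Qed.

Lemma measurable_linear_power a b :
  measurable_fun setT (fun s : K => (cmod (a + b * u s) `^ p)%:E).
Proof.
apply/measurable_EFinP; apply: (measurableT_comp (measurable_powR _)).
apply: measurable_cmod; apply: cmeasurableD; first exact: cmeasurable_cst.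
by apply: cmeasurableM; [exact: cmeasurable_cst|exact: cmeasurable_circle].
Qed.

Lemma linear_integral_phase a b : linear_integral a b = linear_integral a (cmod b)%:C.
Proof.
have [s sp bE] := polar b.
rewrite /linear_integral -(circle_integral_shift sp (f := fun t => (cmod (a + (cmod b)%:C * u t) `^ p)%:E)).
- congr circle_integral; apply/funext => t.
  by rewrite {1}bE circleD [u t * _]mulrC mulrA.
- exact: measurable_linear_power.
- by move=> t; rewrite lee_fin powR_ge0.
- by move=> t; rewrite circle_period.
Qed.

Lemma cmod_linear_swap a b s : cmod (a + b * u s) = cmod (b^*%C + a^*%C * u s).
Proof.
have -> : b^*%C + a^*%C * u s = u s * (a + b * u s)^*%C.
  rewrite rmorphD rmorphM /= mulrDr mulrCA circle_conj mulr1 addrC.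
  by rewrite [u s * _]mulrC.
by rewrite cmodM cmod_circle mul1r cmod_conj.
Qed.

Lemma linear_integral_swap a b : linear_integral a b = linear_integral b^*%C a^*%C.
Proof.
by congr circle_integral; apply/funext => s; rewrite cmod_linear_swap.
Qed.

(** A shift of the variable removes the phase of b, and conjugation exchanges the
    roles of a and b. *)
Lemma linear_integral_cmod a b :
  linear_integral a b = linear_integral (cmod a)%:C (cmod b)%:C.
Proof.
rewrite linear_integral_phase linear_integral_swap linear_integral_phase cmod_conj.
by rewrite linear_integral_swap !conjc_real.
Qed.

Lemma linear_integral_sym a b : linear_integral a b = linear_integral b a.
Proof.
by rewrite linear_integral_cmod linear_integral_swap !conjc_real -linear_integral_cmod.
Qed.

(** For A >= B >= 0 one has |A + B u| >= B |1 + u| on the circle. *)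
Lemma linear_integral_ge a b : cmod b <= cmod a ->
  ((cmod b `^ p)%:E * linear_integral 1%R 1%R <= linear_integral a b)%E.
Proof.
move=> ba; rewrite [leRHS]linear_integral_cmod /linear_integral /circle_integral.
rewrite -ge0_integralZl //.
- apply: ge0_le_integral => //.
  + by move=> s _; rewrite mule_ge0 // lee_fin powR_ge0.
  + apply: measurable_funTS; apply: measurable_funeM; exact: measurable_linear_power.
  + by apply: measurable_funTS; exact: measurable_linear_power.
  move=> s _; rewrite -EFinM -powRM // lee_fin ge0_ler_powR ?nnegrE ?mulr_ge0 // ?(ltW p0) //.
  rewrite -(@ler_pXn2r _ 2) ?nnegrE ?mulr_ge0 // exprMn [cmod (1 + _) ^+ 2]sqr_cmod [leRHS]sqr_cmod /=.
  move: (cmod_ge0 b) ba; move: (cmod a) (cmod b) => A B B0 BA.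
  have := cos2Dsin2 s; have := cos_geN1 s; move: (cos s) (sin s) => x y x1.
  rewrite !mul1r !mul0r !add0r !subr0 !addr0 => c1.
  have h : 0 <= (A - B) * (A + B + 2 * (B * x)).
    by rewrite mulr_ge0 ?subr_ge0 //; nra.
  have y2 : y ^+ 2 = 1 - x ^+ 2 by lra.
  have -> : (B * y) ^+ 2 = B ^+ 2 * (1 - x ^+ 2) by rewrite exprMn y2.
  rewrite y2; lra.
- by apply: measurable_funTS; exact: measurable_linear_power.
- by move=> s _; rewrite lee_fin powR_ge0.
- by rewrite lee_fin powR_ge0.
Qed.


(** The mean over gamma of Arestov's inequality for S + rho u(gamma) T. On the left,
    Tonelli and [linear_integral_ge] at each point of the circle; on the right, the
    radius rho is removed by monotonicity of power means. *)
Lemma power_integral_pencil n (t s0 : C) (S T : {poly C} -> {poly C}) P (rho : K) :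
  (size P <= n.+1)%N -> 0 <= rho <= 1 ->
  (forall s, cmod (T P).[u s] <= cmod (S P).[u s]) ->
  (forall s, zero_free_preserver n (s0 + rho%:C * u s * t)
     (fun F => S F + (rho%:C * u s) *: T F)) ->
  ((rho `^ p)%:E * (power_integral (T P) * linear_integral 1%R 1%R) <=
   linear_integral t s0 * power_integral P)%E.
Proof.
move=> sP /andP[r0 r1] le pres.
pose h x g := ((cmod ((S P).[u x] + rho%:C * (T P).[u x] * u g)) `^ p)%:E.
have mh d (X : measurableType d) (v w : X -> K) :
    measurable_fun setT v -> measurable_fun setT w ->
    measurable_fun setT (fun z => h (v z) (w z)).
  move=> mv mw; apply/measurable_EFinP; apply: (measurableT_comp (measurable_powR _)).
  apply: measurable_cmod; apply: cmeasurableD.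
    by apply: cmeasurable_horner; exact: cmeasurable_circle.
  apply: cmeasurableM; last exact: cmeasurable_circle.
  apply: cmeasurableM; first exact: cmeasurable_cst.
  by apply: cmeasurable_horner; exact: cmeasurable_circle.
have h0 x g : (0 <= h x g)%E by rewrite lee_fin powR_ge0.
have mp Q : measurable_fun setT (fun s => (cmod Q.[u s] `^ p)%:E).
  apply/measurable_EFinP; apply: (measurableT_comp (measurable_powR _)).
  exact: measurable_cmod_horner.
have p0' Q s : (0 <= (cmod Q.[u s] `^ p)%:E)%E by rewrite lee_fin powR_ge0.
(* finite, so that it can be moved inside an integral *)
have [l l0 lE] : exists2 l : K, 0 <= l & linear_integral 1 1 = l%:E.
  exists (fine (linear_integral 1 1)).
    by rewrite fine_ge0 // linear_integralE power_integral_ge0.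
  by rewrite fineK // linear_integralE power_integral_fin.
have [q q0 qE] : exists2 q : K, 0 <= q & power_integral P = q%:E.
  exists (fine (power_integral P)); first by rewrite fine_ge0 // power_integral_ge0.
  by rewrite fineK // power_integral_fin.
have lower : ((rho `^ p)%:E * (power_integral (T P) * linear_integral 1%R 1%R) <=
    circle_integral (fun x => circle_integral (h x)))%E.
  have -> : ((rho `^ p)%:E * (power_integral (T P) * linear_integral 1%R 1%R) =
     circle_integral (fun s => (rho `^ p * l)%:E * (cmod (T P).[u s] `^ p)%:E))%E.
    rewrite lE [X in (_ * X)%E]muleC muleA -EFinM [RHS]ge0_integralZl //.
    - by apply: measurable_funTS; exact: mp.
    - by rewrite lee_fin mulr_ge0 // powR_ge0.
  apply: ge0_le_integral => //.
  - by move=> s _; rewrite mule_ge0 // lee_fin mulr_ge0 // powR_ge0.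
  - by apply: measurable_funTS; apply: measurable_funeM; exact: mp.
  - apply: measurable_funTS.
    apply: (@measurable_integral_in K `[0, 2 * pi] (fun g x => h x g)) => //.
    exact: mh measurable_snd measurable_fst.
  - move=> s _; rewrite -EFinM mulrAC EFinM -powRM // -lE.
    have <- : cmod (rho%:C * (T P).[u s]) = rho * cmod (T P).[u s].
      by rewrite cmodM cmod_real ger0_norm.
    apply: linear_integral_ge.
    by rewrite cmodM cmod_real ger0_norm // (le_trans _ (le s)) // ler_piMl.
apply: (le_trans lower).
rewrite /circle_integral (@tonelli_in K `[0, 2 * pi] `[0, 2 * pi] h) //; last first.
  exact: mh measurable_fst measurable_snd.
have upper : (linear_integral s0 (rho%:C * t)%R <= linear_integral s0 t)%E.
  have sL : (size (s0%:P + t *: 'X : {poly C})%R <= 2)%N.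
    rewrite (leq_trans (size_polyD _ _)) // geq_max (leq_trans (size_polyC_leq1 _)) //.
    by rewrite (leq_trans (size_scale_leq _ _)) // size_polyX.
  have dil : zero_free_preserver 1 1 (dilate rho).
    by apply: dilation_preserver; rewrite r0.
  have := arestov dil sL p0; rewrite cmod1 powR1 mul1e -!/(power_integral _) -linear_integralE.
  apply: le_trans; rewrite le_eqVlt; apply/orP; left; apply/eqP.
  congr circle_integral; apply/funext => s.
  by rewrite horner_dilate !hornerE /=; congr ((cmod _ `^ p)%:E); ring.
apply: (@le_trans _ _ (linear_integral s0 (rho%:C * t)%R * power_integral P)%E); last first.
  rewrite [linear_integral t s0]linear_integral_sym.
  by rewrite lee_wpmul2r // power_integral_ge0.
rewrite [leRHS]muleC qE -[leRHS]ge0_integralZl //; last 2 first.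
- by apply: measurable_funTS; exact: measurable_linear_power.
- by move=> s _; rewrite lee_fin powR_ge0.
apply: ge0_le_integral => //.
- by move=> g _; exact: integral_ge0.
- apply: measurable_funTS; apply: measurable_integral_in => //.
  exact: mh measurable_fst measurable_snd.
- by apply: measurable_funTS; apply: measurable_funeM; exact: measurable_linear_power.
move=> g _; have := arestov (pres g) sP p0.
rewrite -/(power_integral P) qE muleC.
have -> : s0 + rho%:C * u g * t = s0 + rho%:C * t * u g by ring.
apply: le_trans; rewrite le_eqVlt; apply/orP; left; apply/eqP.
congr circle_integral; apply/funext => x; rewrite /h !hornerE.
by congr ((cmod _ `^ p)%:E); ring.
Qed.

(** The limit rho -> 1 of [power_integral_pencil]. *)
Lemma power_integral_star n (t s0 : C) (S T : {poly C} -> {poly C}) P :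
  (size P <= n.+1)%N ->
  (forall s, cmod (T P).[u s] <= cmod (S P).[u s]) ->
  (forall eta, cmod eta < 1 -> zero_free_preserver n (s0 + eta * t)
     (fun F => S F + eta *: T F)) ->
  (power_integral (T P) * linear_integral 1%R 1%R <=
   linear_integral t s0 * power_integral P)%E.
Proof.
move=> sP le pres.
have fin Q : exists2 q : K, 0 <= q & power_integral Q = q%:E.
  exists (fine (power_integral Q)); first by rewrite fine_ge0 // power_integral_ge0.
  by rewrite fineK // power_integral_fin.
have [x x0 xE] := fin (T P); have [y y0 yE] := fin P.
have [l l0 lE] : exists2 l : K, 0 <= l & linear_integral 1 1 = l%:E.
  by rewrite linear_integralE; exact: fin.
have [m m0 mE] : exists2 m : K, 0 <= m & linear_integral t s0 = m%:E.
  by rewrite linear_integralE; exact: fin.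
have key rho : 0 <= rho < 1 -> rho `^ p * (x * l) <= m * y.
  move=> /andP[r0 r1]; rewrite -lee_fin !EFinM -xE -lE -mE -yE.
  apply: (power_integral_pencil (n := n)) => //; first by rewrite r0 ltW.
  by move=> s; apply: pres; rewrite cmodM cmod_circle mulr1 cmod_real ger0_norm.
rewrite xE lE mE yE -!EFinM lee_fin leNgt; apply/negP => lt.
have my0 : 0 <= m * y by rewrite mulr_ge0.
have xl0 : 0 < x * l by exact: le_lt_trans lt.
(* rho = c^(1/p) makes the left side the midpoint of m y and x l *)
pose c := (m * y + x * l) / (2 * (x * l)).
have c0 : 0 <= c by rewrite divr_ge0 //; lra.
have c1 : c < 1 by rewrite ltr_pdivrMr; lra.
have := key (c `^ p^-1); rewrite -powRrM mulVf ?gt_eqF // powRr1 //.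
have cE (w : K) : w != 0 -> (m * y + w) / (2 * w) * w = (m * y + w) / 2 by move=> w0; field.
rewrite {2}/c cE ?gt_eqF //.
rewrite powR_ge0 /= => H.
have ip : 0 < p^-1 by rewrite invr_gt0.
have := @gt0_ltr_powR K _ ip c 1; rewrite powR1 !nnegrE => /(_ c0 ler01 c1) c1p.
by have := H c1p; lra.
Qed.

End Means.

(** * Norms, extremal polynomials and the theorem *)

Section Norms.
Context {K : realType}.
Local Notation C := K[i].
Local Notation u := (@unit_circle K).
Implicit Types (p : K) (P Q : {poly C}) (a b : C).

Lemma normp_pos p P : 0 < p ->
  normp p P = ((2 * pi)^-1 * fine (power_integral p P)) `^ p^-1.
Proof. by move=> p0; rewrite /normp gt_eqF. Qed.

Lemma normp_zero P : normp 0 P = norm0 P.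
Proof. by rewrite /normp eqxx. Qed.

Lemma fine_mule_le (x y z t : \bar K) : x \is a fin_num -> y \is a fin_num ->
  z \is a fin_num -> t \is a fin_num -> (x * y <= z * t)%E ->
  fine x * fine y <= fine z * fine t.
Proof. by case: x y z t => [x||] [y||] [z||] [t||]. Qed.

(** Passes from integrals to normalized p-th roots, with c = 1/(2 pi) and q = 1/p. *)
Lemma mean_powR_mul_le (q c x y z t : K) : 0 <= q -> 0 <= c -> 0 <= x -> 0 <= y ->
  0 <= z -> 0 <= t -> x * y <= z * t ->
  (c * x) `^ q * (c * y) `^ q <= (c * z) `^ q * (c * t) `^ q.
Proof.
move=> q0 c0 x0 y0 z0 t0 xyzt; rewrite -!powRM ?mulr_ge0 //.
rewrite ge0_ler_powR ?nnegrE ?mulr_ge0 //.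
by rewrite mulrACA [leRHS]mulrACA ler_wpM2l // mulr_ge0.
Qed.

Lemma mean_ge0 p P : 0 < p -> 0 <= (2 * pi)^-1 * fine (power_integral p P).
Proof.
move=> p0; rewrite mulr_ge0 ?invr_ge0 ?mulr_ge0 ?pi_ge0 //.
by rewrite fine_ge0 // power_integral_ge0.
Qed.

Lemma power_integralZ p a P : 0 < p ->
  power_integral p (a *: P) = ((cmod a `^ p)%:E * power_integral p P)%E.
Proof.
move=> p0; rewrite /power_integral /circle_integral -ge0_integralZl //.
- by apply: eq_integral => s _; rewrite hornerZ cmodM powRM // EFinM.
- apply/measurable_funTS/measurable_EFinP.
  by apply: (measurableT_comp (measurable_powR _)); exact: measurable_cmod_horner.
- by move=> s _; rewrite lee_fin powR_ge0.
- by rewrite lee_fin powR_ge0.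
Qed.

Lemma normpZ p a P : 0 <= p -> normp p (a *: P) = cmod a * normp p P.
Proof.
rewrite le_eqVlt => /predU1P[<-|p0]; first by rewrite !normp_zero norm0Z.
rewrite !(normp_pos _ p0) power_integralZ // fineM ?power_integral_fin //=.
rewrite mulrCA powRM ?powR_ge0 ?mean_ge0 //; congr (_ * _).
by rewrite -powRrM divff ?gt_eqF // powRr1.
Qed.

Lemma normp_linear_cmod p a b a' b' : 0 <= p -> cmod a = cmod a' -> cmod b = cmod b' ->
  normp p (a%:P + b *: 'X) = normp p (a'%:P + b' *: 'X).
Proof.
rewrite le_eqVlt => /predU1P[<-|p0] aa bb.
  by rewrite !normp_zero !norm0_linear aa bb.
have e : power_integral p (a%:P + b *: 'X) = power_integral p (a'%:P + b' *: 'X).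
  rewrite -(linear_integralE p a b) -(linear_integralE p a' b').
  by rewrite (linear_integral_cmod p a b) (linear_integral_cmod p a' b') aa bb.
by rewrite !(normp_pos _ p0) e.
Qed.

(** Invariance under t -> n t, applied to a nonnegative deficit since the logarithm
    has no sign. *)
Lemma log_integral_binomial n a b : (0 < n)%N ->
  log_integral (a%:P + b *: 'X^n) = log_integral (a%:P + b *: 'X).
Proof.
move=> n0; set P := a%:P + b *: 'X.
have E s : (a%:P + b *: 'X^n).[u s] = P.[u (n%:R * s)].
  by rewrite circleMn !hornerE.
have [M M0 PM] := bounded_horner P 1.
pose c := ln (M + 1); have ec : expR c = M + 1 by rewrite lnK // posrE; lra.
have d0 s : (0 <= c%:E - lne (cmod P.[u s])%:E)%E.
  rewrite subre_ge0 // -[c in leRHS]expRK; apply: lne_le_ln; first exact: expR_gt0.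
  by rewrite ec (le_trans (PM _ _)) ?cmod_circle //; lra.
have H : circle_integral (fun s => c%:E - lne (cmod P.[u (n%:R * s)])%:E)%E =
    circle_integral (fun s => c%:E - lne (cmod P.[u s])%:E)%E.
  apply: (@circle_integral_muln K n (fun s => c%:E - lne (cmod P.[u s])%:E)%E n0) => // [|s].
    apply: emeasurable_funB; first exact: measurable_cst.
    by apply: measurable_lne; exact: measurable_cmod_horner.
  by rewrite circle_period.
move: H; rewrite circle_integral_horner_deficit.
under eq_fun do rewrite -E; rewrite circle_integral_horner_deficit.
move: (log_integral (_ + _)) (log_integral P) => [x||] [y||] //.
by rewrite -!EFinB => -[/addrI /oppr_inj ->].
Qed.

Lemma normp_binomial p n a b : 0 <= p -> (0 < n)%N ->
  normp p (a%:P + b *: 'X^n) = normp p (a%:P + b *: 'X).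
Proof.
move=> + n0; rewrite le_eqVlt => /predU1P[<-|p0].
  by rewrite !normp_zero !norm0E log_integral_binomial.
have e : power_integral p (a%:P + b *: 'X^n) = power_integral p (a%:P + b *: 'X).
  rewrite /power_integral.
  transitivity (circle_integral (fun s => (cmod (a%:P + b *: 'X).[u (n%:R * s)] `^ p)%:E)).
    by congr circle_integral; apply/funext => s; rewrite circleMn !hornerE.
  apply: (@circle_integral_muln K n (fun s => (cmod (a%:P + b *: 'X).[u s] `^ p)%:E) n0) => [|s|s].
  - apply/measurable_EFinP.
    by apply: (measurableT_comp (measurable_powR _)); exact: measurable_cmod_horner.
  - by rewrite lee_fin powR_ge0.
  - by rewrite circle_period.
by rewrite !(normp_pos _ p0) e.
Qed.

(** The mean of |1 + u|^p is at least 1, its value at radius zero. *)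
Lemma normp_1X_gt0 p : 0 <= p -> 0 < normp p (1 + 'X : {poly C}).
Proof.
have E : 1 + 'X = 1%:P + 1 *: 'X :> {poly C} by rewrite polyC1 scale1r.
rewrite le_eqVlt => /predU1P[<-|p0].
  by rewrite normp_zero E norm0_linear cmod1 maxxx.
rewrite (normp_pos _ p0) powR_gt0 // mulr_gt0 ?invr_gt0 ?pi2_gt0 //.
rewrite fine_gt0 // -ge0_fin_numE ?power_integral_ge0 // power_integral_fin // andbT.
have dil : zero_free_preserver 1 1 (@dilate K 0).
  by apply: dilation_preserver; rewrite lexx ler01.
have sL : (size (1 + 'X : {poly C})%R <= 2)%N by rewrite addrC -polyC1 size_XaddC.
have := arestov dil sL p0; rewrite cmod1 powR1 mul1e; apply: lt_le_trans.
rewrite (_ : (fun t => _) = fun=> 1%:E); last first.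
  apply/funext => s; rewrite horner_dilate mul0r !hornerE.
  by rewrite cmod1 powR1.
by rewrite circle_integral_cst mulr1 lte_fin pi2_gt0.
Qed.

End Norms.

Section Main.
Context {K : realType} (n : nat) (hn : (0 < n)%N).
Local Notation C := K[i].
Local Notation u := (@unit_circle K).
Context (l0 l1 l2 : C) (hB : inB n l0 l1 l2).
Context (R r : K) (hr : 1 <= r) (hR : r < R).
Context (f : C) (hf : cmod f <= ((R + 1) / (r + 1)) ^+ n).
Implicit Types P : {poly C}.

Definition operator P := Bop n l0 l1 l2 (dilate R P) + f *: Bop n l0 l1 l2 (dilate r P).

Definition operator_eigenvalue k :=
  ((R ^+ k)%:C + f * (r ^+ k)%:C) * Bop_eigenvalue n l0 l1 l2 k.
Local Notation t := operator_eigenvalue.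

Lemma coef_operator P k : (operator P)`_k = t k * P`_k.
Proof. by rewrite /operator coefD coefZ !coef_Bop !coef_dilate /t; ring. Qed.

Lemma operatorE P : (size P <= n.+1)%N -> operator P = multiplier n t P.
Proof. by move=> sP; apply/polyP => k; rewrite coef_operator coef_multiplier. Qed.

Lemma operator_zeros_in_disc P : zeros_in_disc n P ->
  forall z, 1 < cmod z -> (multiplier n t P).[z] != 0.
Proof.
move=> Pz z z1; rewrite -operatorE; last by case: Pz => ->.
rewrite (_ : operator P = Bop n l0 l1 l2 (dilate R P + f *: dilate r P)).
  exact: (Bop_neq0 hn hB (dilation_combination_zeros hr hR hn hf Pz)).
apply/polyP => k; rewrite coef_operator coef_Bop coefD coefZ !coef_dilate /t; ring.
Qed.

Lemma operator_eigenvalue_n : t n = ((R ^+ n)%:C + f * (r ^+ n)%:C) * Lambda n l0 l1 l2.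
Proof. by rewrite /t Bop_eigenvalue_n. Qed.

Lemma operator_eigenvalue_0 : t 0%N = (1 + f) * l0.
Proof. by rewrite /t /Bop_eigenvalue !expr0 mul0n; ring. Qed.

Lemma operator_eigenvalue_n_neq0 : t n != 0.
Proof.
rewrite operator_eigenvalue_n mulf_neq0 ?(Lambda_neq0 hn hB) //.
have Xz : zeros_in_disc n ('X^n : {poly C}).
  split=> [|z z1]; first by rewrite size_polyXn.
  by rewrite hornerXn expf_neq0 // -cmod_gt0 (lt_trans _ z1).
have [sX _] := dilation_combination_zeros hr hR hn hf Xz.
apply: contra_eq_neq sX => e.
suff -> : dilate R ('X^n) + f *: dilate r ('X^n) = 0 :> {poly C} by rewrite size_poly0.
apply/polyP => k; rewrite coefD coefZ !coef_dilate coefXn coef0.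
case: eqP => [->|_]; last by rewrite !mulr0 addr0.
by rewrite !mulr1.
Qed.

Lemma operator_binomial a b : operator (a *: 'X^n + b%:P) = (t 0%N * b)%:P + (t n * a) *: 'X^n.
Proof.
apply/polyP => k; rewrite coef_operator !coefD !coefZ !coefC !coefXn.
case: k => [|k] /=; first by rewrite eq_sym (gtn_eqF hn) !mulr0 add0r addr0.
by case: eqP => [->|_] /=; rewrite ?mulr1 ?mulr0 ?addr0 ?add0r ?mulr0.
Qed.

(** For p = 0 the geometric mean of T' P is |t_n P(0)|; for p > 0 this is
    [power_integral_star]. *)
Lemma normp_operator_le p P : 0 <= p -> (size P <= n.+1)%N -> zero_free_disc P ->
  normp p (operator P) * normp p (1 + 'X) <=
  normp p ((t 0%N)%:P + t n *: 'X) * normp p P.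
Proof.
move=> + sP Pz; have le := le_star operator_zeros_in_disc operator_eigenvalue_n_neq0 sP Pz.
have X1 : 1 + 'X = 1%:P + 1 *: 'X :> {poly C} by rewrite polyC1 scale1r.
have sp := star_preserver operator_zeros_in_disc operator_eigenvalue_n_neq0.
rewrite (operatorE sP) X1 le_eqVlt => /predU1P[<-|p0].
  rewrite !normp_zero !norm0_linear cmod1 maxxx mulr1.
  apply: (@le_trans _ _ (cmod (t n) * norm0 P)); last first.
    by rewrite ler_wpM2r ?norm0_ge0 // le_max lexx orbT.
  by apply: le_trans (le_norm0 le) _; rewrite -(cmod_conj (t n)); exact: (preserver_norm0 sp).
have := power_integral_star p0 sP le
  (fun eta h => star_pencil_preserver operator_zeros_in_disc operator_eigenvalue_n_neq0 h).
set TP := multiplier n t P.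
rewrite (linear_integral_cmod p (t 0%N)) cmod_conj -(linear_integral_cmod p (t 0%N)).
rewrite !linear_integralE => ineq.
have fin Q := power_integral_fin p0 Q.
have ge Q : 0 <= fine (power_integral p Q) by rewrite fine_ge0 // power_integral_ge0.
rewrite !(normp_pos _ p0); apply: mean_powR_mul_le (fine_mule_le _ _ _ _ ineq);
  rewrite ?invr_ge0 ?ge ?fin ?(ltW p0) ?(ltW pi2_gt0) //.
Qed.

End Main.

Theorem theorem1p1 (K : realType) (n : nat) (hn : (1 <= n)%N)
  (l0 l1 l2 : K[i]) (hB : inB n l0 l1 l2)
  (alpha beta : K[i]) (halpha : `|alpha| <= 1) (hbeta : `|beta| <= 1)
  (R r : K) (hr : 1 <= r) (hR : r < R) (p : K) (hp : 0 <= p) :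
  let B := Bop n l0 l1 l2 in
  let f := phi n R r alpha beta in
  let lhs := fun P : {poly K[i]} =>
    normp p (B (dilate R P) + f *: B (dilate r P)) in
  let M :=
    normp p ((((R ^+ n)%:C + f * (r ^+ n)%:C) * Lambda n l0 l1 l2) *: 'X
             + ((1 + f) * l0)%:P) / normp p (1 + 'X) in
  [/\ (forall P : {poly K[i]}, Pn n P -> zero_free_disc P ->
         lhs P <= M * normp p P),
      (forall a b : K[i], `|a| = `|b| -> `|b| != 0 ->
         lhs (a *: 'X^n + b%:P) = M * normp p (a *: 'X^n + b%:P))
    & (forall c : K,
         (forall P : {poly K[i]}, Pn n P -> zero_free_disc P ->
            lhs P <= c * normp p P) -> M <= c)].
Proof.
move=> B f lhs M.
have r0 : 0 < r by rewrite (lt_le_trans ltr01).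
have a1 : cmod alpha <= 1 by rewrite -lecR -normr_cmod.
have b1 : cmod beta <= 1 by rewrite -lecR -normr_cmod.
have hf : cmod f <= ((R + 1) / (r + 1)) ^+ n by exact: cmod_phi_le.
pose t := operator_eigenvalue n l0 l1 l2 R r f.
have X0 := @normp_1X_gt0 K p hp.
have ME : M = normp p ((t 0%N)%:P + t n *: 'X) / normp p (1 + 'X).
  by rewrite /M /t operator_eigenvalue_n operator_eigenvalue_0 [in RHS]addrC.
have cancel (x y z : K) : z != 0 -> x * y = y / z * (x * z) by move=> z0; field.
have eqab a b : `|a| = `|b| -> lhs (a *: 'X^n + b%:P) = M * normp p (a *: 'X^n + b%:P).
  move=> ab; have {}ab : cmod a = cmod b by rewrite /cmod ab.
  have aX : normp p (a *: 'X^n + b%:P) = cmod b * normp p (1 + 'X).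
    have -> : a *: 'X^n + b%:P = b%:P + a *: 'X^n by rewrite addrC.
    rewrite (normp_binomial b a hp hn) -(normpZ b _ hp).
    have -> : b *: (1 + 'X) = b%:P + b *: 'X by rewrite scalerDr alg_polyC.
    exact: (normp_linear_cmod hp erefl ab).
  have lE : lhs (a *: 'X^n + b%:P) = cmod b * normp p ((t 0%N)%:P + t n *: 'X).
    rewrite /lhs -/(operator n l0 l1 l2 R r f _) (operator_binomial hn).
    rewrite (normp_binomial _ _ hp hn) -(normpZ b _ hp).
    have -> : b *: ((t 0%N)%:P + t n *: 'X) = (b * t 0%N)%:P + (b * t n) *: 'X.
      by rewrite scalerDr scalerA -mul_polyC -polyCM.
    by apply: (normp_linear_cmod hp); rewrite !cmodM ?ab mulrC.
  apply: (etrans lE); rewrite aX ME; apply: cancel.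
  by rewrite gt_eqF.
split=> [P sP Pz|a b ab _|c H].
- have sPn : (size P <= n.+1)%N by rewrite sP.
  have le := normp_operator_le hn hB hr hR hf hp sPn Pz.
  by rewrite ME mulrAC ler_pdivlMr.
- exact: eqab.
(* the extremal z^n + 1 forces M <= c *)
- pose P : {poly K[i]} := 1 *: 'X^n + 1%:P.
  have PX : P = 'X^n + 1%:P by rewrite /P scale1r.
  have sP : size P = n.+1 by rewrite PX size_XnaddC.
  have Pz : zero_free_disc P.
    apply/zero_free_discP => z z1; rewrite PX !hornerE addr_eq0.
    apply/negP => /eqP /(congr1 (@cmod K)); rewrite cmodX cmodN cmod1 => e.
    by have := exprn_ilt1 n (cmod_ge0 z) z1; rewrite e ltxx -lt0n hn.
  have nP : 0 < normp p P.
    have -> : P = 1%:P + 1 *: 'X^n by rewrite addrC.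
    by rewrite (normp_binomial 1 1 hp hn) scale1r polyC1.
  have := H P sP Pz; rewrite [lhs P](eqab 1 1 erefl).
  by rewrite ler_pM2r.
Qed.
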